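(* Let $(A_N)_{N\geq 1}$ and $(B_N)_{N\geq 1}$ be two deterministic sequences of $N\times N$ Hermitian matrices (respectively real symmetric matrices), and let $(v_N)_{N\geq 1}$ be a sequence of unit vectors of $\mathbb{C}^N$ (resp. of $\mathbb{R}^N$). Assume that almost surely, as $N\to\infty$, the following convergences hold in moment: $\mu_{A_N}\to \mu_1$, $\mu_{A_N}^{v_N}\to \nu_1$ and $\mu_{B_N}\to \mu_2$, for some probability measures $\mu_1,\nu_1,\mu_2$ on $\mathbb{R}$. Let $(U_N)_{N\geq 1}$ be a sequence of Haar distributed unitary (resp. orthogonal) random matrices of size $N$. Then there exist unital linear functionals $\tau,\varphi:\mathbb{C}\langle X,Y\rangle\to\mathbb{C}$ such that: (i) for all $P\in \mathbb{C}\langle X,Y\rangle$, $\frac{1}{N}\operatorname{Tr}(P(A_N, U_NB_NU_N^* ))=\tau(P)+o(1)$ almost surely; (ii) for all $P\in \mathbb{C}\langle X,Y\rangle$, $\langle P(A_N, U_NB_NU_N^* )v_N,v_N\rangle=\varphi(P)+o(1)$ almost surely; (iii) the unital subalgebras $\mathbb{C}\langle X\rangle$ and $\mathbb{C}\langle Y\rangle$ are conditionally free with respect to $(\tau,\varphi)$.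
   Context: $\mathbb{C}\langle X,Y\rangle$ denotes the algebra of non-commutative polynomials in two variables. For an $N\times N$ Hermitian matrix $M$, $\mu_M=\frac1N\sum_\lambda\delta_\lambda$ (eigenvalues with multiplicity), and for a unit vector $v$, $\mu_M^v$ is the probability measure with $\int x^kd\mu_M^v=\langle M^kv,v\rangle$ for all $k$. Convergence in moment of $\mu_N$ to $\mu$ means $\int x^kd\mu_N\to\int x^kd\mu$ for all $k\ge0$. Given a unital algebra $\mathcal{A}$ and two unital linear functionals $\tau,\varphi$ on it, unital subalgebras $\mathcal{A}_1,\mathcal{A}_2$ are conditionally free with respect to $(\tau,\varphi)$ if whenever $n>1$, $a_j\in\mathcal{A}_{i_j}$ with $i_1\neq i_2\neq\cdots\neq i_n$ (consecutive indices distinct) and $\tau(a_1)=\cdots=\tau(a_n)=0$, one has $\tau(a_1\cdots a_n)=0$ and $\varphi(a_1\cdots a_n)=\varphi(a_1)\cdots\varphi(a_n)$. *)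

(* Defs.v *)
(* MathComp + MathComp-Analysis (abstract R : realType), complex numbers
   C := R[i] from mathcomp-real-closed. *)
From HB Require Import structures.
From mathcomp Require Import all_boot all_order all_algebra.
From mathcomp Require Import all_classical all_reals all_analysis.
From mathcomp Require Import complex.
Set Implicit Arguments. Unset Strict Implicit. Unset Printing Implicit Defensive.
Import Order.TTheory GRing.Theory Num.Theory.
Import numFieldNormedType.Exports.
Local Open Scope ring_scope.
Local Open Scope classical_set_scope.

Section Defs.
Variable R : realType.
Local Notation C := R[i].

(* ---------- linear algebra on C^n ---------- *)
(* conjugate transpose M^* *)
Definition mxadj (m n : nat) (M : 'M[C]_(m, n)) : 'M[C]_(n, m) :=
  (map_mx (fun z : C => z^*) M)^T.

Definition hermitian (n : nat) (M : 'M[C]_n) : Prop := mxadj M = M.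
Definition unitary (n : nat) (U : 'M[C]_n) : Prop := mxadj U *m U = 1%:M.
Definition real_mx (m n : nat) (M : 'M[C]_(m, n)) : Prop :=
  forall i j, complex.Im (M i j) = 0.

(* <x, y> = y^* x  (linear in the first argument) *)
Definition inner (n : nat) (x y : 'cV[C]_n) : C := (mxadj y *m x) 0 0.
Definition unit_vec (n : nat) (v : 'cV[C]_n) : Prop := inner v v = 1.

(* normalized trace (1/N) Tr M *)
Definition ntr (n : nat) (M : 'M[C]_n) : C := (\tr M) / n%:R.

(* In the real case (realc = true): real symmetric matrices, real unit vectors,
   orthogonal matrices; otherwise Hermitian matrices, complex unit vectors,
   unitary matrices. *)
Definition selfadj (realc : bool) (n : nat) (M : 'M[C]_n) : Prop :=
  hermitian M /\ (realc -> real_mx M).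
Definition admissible_vec (realc : bool) (n : nat) (v : 'cV[C]_n) : Prop :=
  unit_vec v /\ (realc -> real_mx v).
Definition in_group (realc : bool) (n : nat) (V : 'M[C]_n) : Prop :=
  unitary V /\ (realc -> real_mx V).

(* ---------- convergence of complex sequences ---------- *)
Definition cvgC (u : nat -> C) (l : C) : Prop :=
  (fun N => complex.Re (u N)) @ \oo --> complex.Re l /\
  (fun N => complex.Im (u N)) @ \oo --> complex.Im l.

(* ---------- moments of a probability measure on R ---------- *)
Definition has_moments (mu : probability R R) : Prop :=
  forall k : nat, mu.-integrable setT (fun x : R => (x ^+ k)%:E).
Definition moment (mu : probability R R) (k : nat) : R :=
  fine (\int[mu]_x (x ^+ k)%:E)%E.

(* ---------- non-commutative polynomials C<X,Y> ---------- *)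
(* A word in the letters X (false) and Y (true); a polynomial is a formal
   finite linear combination of words. *)
Definition word := seq bool.
Definition ncpoly := seq (C * word).

Definition ncmul (P Q : ncpoly) : ncpoly :=
  [seq (p.1 * q.1, p.2 ++ q.2) | p <- P, q <- Q].
Definition ncprod (s : seq ncpoly) : ncpoly := foldr ncmul [:: (1, [::])] s.

(* evaluation of a word / polynomial at (X, Y) := (M1, M2) *)
Definition ev_word (n : nat) (w : word) (M1 M2 : 'M[C]_n) : 'M[C]_n :=
  foldr (fun b acc => (if b then M2 else M1) *m acc) 1%:M w.
Definition ev (n : nat) (P : ncpoly) (M1 M2 : 'M[C]_n) : 'M[C]_n :=
  \sum_(m <- P) m.1 *: ev_word m.2 M1 M2.

(* A linear functional on C<X,Y> is determined by its values on the basis of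
   words; lin f is its linear extension.  It is unital iff f [::] = 1. *)
Definition lin (f : word -> C) (P : ncpoly) : C := \sum_(m <- P) m.1 * f m.2.
Definition unital (f : word -> C) : Prop := f [::] = 1.

(* one-variable polynomials (coefficient, degree) and their embedding into
   C<X> (i = false) or C<Y> (i = true) *)
Definition poly1 := seq (C * nat).
Definition emb (i : bool) (a : poly1) : ncpoly :=
  [seq (m.1, nseq m.2 i) | m <- a].

(* conditional freeness of C<X> and C<Y> w.r.t. (tau, phi) *)
Definition cond_free (tau phi : word -> C) : Prop :=
  forall s : seq (bool * poly1),
    (1 < size s)%N ->
    sorted (fun x y => x.1 != y.1) s ->
    (forall a, a \in s -> lin tau (emb a.1 a.2) = 0) ->
    lin tau (ncprod [seq emb a.1 a.2 | a <- s]) = 0 /\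
    lin phi (ncprod [seq emb a.1 a.2 | a <- s]) =
      \prod_(a <- s) lin phi (emb a.1 a.2).

(* ---------- Haar distributed random matrices ---------- *)
Section Haar.
Context {d : measure_display} {Omega : measurableType d}.
Variable P : probability Omega R.

(* law of U is invariant under left multiplication by elements of the group
   (unitary, resp. orthogonal), tested on all rectangles
   prod_{ij} (Bre i j x Bim i j) of R^{2 n^2}, which determine the law *)
Definition haar (realc : bool) (n : nat) (U : Omega -> 'M[C]_n) : Prop :=
  (forall i j, measurable_fun setT (fun w => complex.Re (U w i j))) /\
  (forall i j, measurable_fun setT (fun w => complex.Im (U w i j))) /\
  {ae P, forall w, in_group realc (U w)} /\
  (forall V : 'M[C]_n, in_group realc V ->
   forall Bre Bim : 'I_n -> 'I_n -> set R,
     (forall i j, measurable (Bre i j)) -> (forall i j, measurable (Bim i j)) ->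
     P [set w | forall i j, Bre i j (complex.Re (U w i j)) /\
                            Bim i j (complex.Im (U w i j))] =
     P [set w | forall i j, Bre i j (complex.Re ((V *m U w) i j)) /\
                            Bim i j (complex.Im ((V *m U w) i j))]).
End Haar.

End Defs.

(* Main.v *)
(* Every U_N B_N U_N^* is invariant in law under conjugation by the real rotations
   V_t = 1 + t (E_ij - E_ji) + O(t^2), in the unitary as in the orthogonal case.
   Differentiating E[(W x)_i w_j g(psi)] at t = 0, for a word W in trace-zero
   matrices alternating between A- and B-letters and psi = w^T W x, and summing
   over i, j gives a loop equation; with g(psi) = conj(psi)^2 psi its leading
   term is N E|psi|^4, and all others are either products containing the
   normalised trace of a shorter alternating word, or O(E|psi|^2 + E|psi|^3).
   Induction on the length yields E|psi|^4 = O(N^-2) for contractions.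
   Convergence of moments bounds the operator norms of A_N and B_N by N^eps for
   every eps, so that the general bound O(N^(-3/2)) is still summable and
   alternating centred words tend to 0 almost surely, both for the trace and for
   the vector state (where only one B-letter is required). Any word reduces to these by
   merging neighbours of the same kind and centring the letters one by one. *)
Require Import Defs.
From HB Require Import structures.
From mathcomp Require Import all_boot all_order all_algebra.
From mathcomp Require Import all_classical all_reals all_analysis.
From mathcomp Require Import complex ring lra measurable_realfun.
Import Order.TTheory GRing.Theory Num.Theory.
Import numFieldNormedType.Exports.
Set Implicit Arguments. Unset Strict Implicit. Unset Printing Implicit Defensive.
Local Open Scope ring_scope.
Local Open Scope classical_set_scope.
Local Notation "x %:C" := (real_complex _ x) (at level 1, format "x %:C") : ring_scope.

(** * Moduli and contractions *)

Section Modulus.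
Variable R : realType.
Local Notation C := R[i].
Implicit Types z : C.

(** Second moments would only give [E|psi|^2 = O(1/N)], which is not summable; this is why [g] is
    chosen to produce a fourth moment. The induction creates new letters, such as the centred
    product of two old ones, so its bounds must be uniform in the matrices and in the dimension;
    this is what the restriction to contractions provides. Only B-letters move under a rotation, so
    the loop equation is used for words that begin with one: the empty prefix before that letter has
    trace N and yields the leading term. The bounds need letters of trace exactly 0, whereas
    freeness speaks of letters whose trace tends to 0; letters are therefore polynomials whose
    coefficients may vary with N. Conditional freeness then reduces to vanishing: an alternating
    word of length at least two contains a B-letter, and a centred B-letter alone already tends to 0
    in the vector state, so both sides of the identity for [phi] are 0. *)

Definition cabs z : R := ComplexField.Normc.normc z.

Lemma cabsE z : cabs z = Num.sqrt (complex.Re z ^+ 2 + complex.Im z ^+ 2).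
Proof. by case: z. Qed.

Lemma cabs_ge0 z : 0 <= cabs z.
Proof. by rewrite cabsE sqrtr_ge0. Qed.

Lemma cabs0 : cabs 0 = 0.
Proof. exact: ComplexField.Normc.normc0. Qed.

Lemma cabs1 : cabs 1 = 1.
Proof. exact: ComplexField.Normc.normc1. Qed.

Lemma cabsM z1 z2 : cabs (z1 * z2) = cabs z1 * cabs z2.
Proof. exact: ComplexField.Normc.normcM. Qed.

Lemma cabsX z k : cabs (z ^+ k) = cabs z ^+ k.
Proof. by elim: k => [|k IH]; rewrite ?expr0 ?cabs1// !exprS cabsM IH. Qed.

Lemma cabsV z : cabs z^-1 = (cabs z)^-1.
Proof. exact: ComplexField.Normc.normcV. Qed.

Lemma cabsD z1 z2 : cabs (z1 + z2) <= cabs z1 + cabs z2.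
Proof. exact: le_normcD. Qed.

Lemma cabsN z : cabs (- z) = cabs z.
Proof. by rewrite !cabsE; case: z => a b /=; rewrite !sqrrN. Qed.

Lemma cabsB z1 z2 : cabs (z1 - z2) <= cabs z1 + cabs z2.
Proof. by rewrite -(cabsN z2) cabsD. Qed.

Lemma conjE z : z^* = (z^*)%C.
Proof. by []. Qed.

Lemma cReJ z : complex.Re (z^*)%R = complex.Re z.
Proof. by case: z. Qed.

Lemma cImJ z : complex.Im (z^*)%R = - complex.Im z.
Proof. by case: z. Qed.

Lemma cabsJ z : cabs (z^*)%R = cabs z.
Proof. by rewrite !cabsE cReJ cImJ sqrrN. Qed.

Lemma cabs_real (a : R) : cabs a%:C = `|a|.
Proof. by rewrite cabsE /= expr0n addr0 sqrtr_sqr. Qed.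

Lemma cabs_nat k : cabs k%:R = k%:R.
Proof.
by rewrite -(rmorph_nat (real_complex R)) cabs_real ger0_norm.
Qed.

Lemma sqr_cabs z : cabs z ^+ 2 = complex.Re z ^+ 2 + complex.Im z ^+ 2.
Proof. by rewrite cabsE sqr_sqrtr// addr_ge0 ?sqr_ge0. Qed.

Lemma mulcJ z : z * (z^*)%R = (cabs z ^+ 2)%:C.
Proof.
rewrite sqr_cabs; case: z => a b; rewrite conjE /=.
by apply/eqP; rewrite eq_complex /=; apply/andP; split; apply/eqP; ring.
Qed.

Lemma Re_le_cabs z : complex.Re z <= cabs z.
Proof.
rewrite cabsE (le_trans (ler_norm _))// -sqrtr_sqr ler_wsqrtr//.
by rewrite lerDl sqr_ge0.
Qed.

Lemma cabs_sum (I : Type) (r : seq I) (Q : pred I) (F : I -> C) :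
  cabs (\sum_(i <- r | Q i) F i) <= \sum_(i <- r | Q i) cabs (F i).
Proof.
elim/big_ind2: _ => [|x1 x2 y1 y2 h1 h2|//]; first by rewrite cabs0.
exact: le_trans (cabsD _ _) (lerD h1 h2).
Qed.

Lemma cReD z1 z2 : complex.Re (z1 + z2) = complex.Re z1 + complex.Re z2.
Proof. by case: z1; case: z2. Qed.
Lemma cImD z1 z2 : complex.Im (z1 + z2) = complex.Im z1 + complex.Im z2.
Proof. by case: z1; case: z2. Qed.
Lemma cReN z : complex.Re (- z) = - complex.Re z.
Proof. by case: z. Qed.
Lemma cImN z : complex.Im (- z) = - complex.Im z.
Proof. by case: z. Qed.
Lemma cReM z1 z2 : complex.Re (z1 * z2) =
  complex.Re z1 * complex.Re z2 - complex.Im z1 * complex.Im z2.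
Proof. by case: z1; case: z2. Qed.
Lemma cImM z1 z2 : complex.Im (z1 * z2) =
  complex.Re z1 * complex.Im z2 + complex.Im z1 * complex.Re z2.
Proof. by case: z1; case: z2. Qed.

Lemma cRe_sum (I : Type) (r : seq I) (Q : pred I) (F : I -> C) :
  complex.Re (\sum_(i <- r | Q i) F i) = \sum_(i <- r | Q i) complex.Re (F i).
Proof. by elim/big_rec2: _ => [//|i x y _ <-]; rewrite cReD. Qed.

End Modulus.

Section CauchySchwarz.
Variable R : realType.

Lemma sum_Cauchy_Schwarz (I : finType) (a b : I -> R) :
  (\sum_i a i * b i) ^+ 2 <= (\sum_i a i ^+ 2) * (\sum_i b i ^+ 2).
Proof.
have h : 0 <= \sum_i \sum_j (a i * b j - a j * b i) ^+ 2.
  by apply: sumr_ge0 => i _; apply: sumr_ge0 => j _; exact: sqr_ge0.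
suff e : \sum_i \sum_j (a i * b j - a j * b i) ^+ 2 =
    2 * ((\sum_i a i ^+ 2) * (\sum_i b i ^+ 2)) - 2 * (\sum_i a i * b i) ^+ 2.
  by rewrite e in h; lra.
transitivity (\sum_i \sum_j (a i ^+ 2 * b j ^+ 2)
   + \sum_i \sum_j (b i ^+ 2 * a j ^+ 2)
   - 2 * \sum_i \sum_j ((a i * b i) * (a j * b j))).
  rewrite mulr_sumr -big_split -sumrB /=; apply: eq_bigr => i _.
  by rewrite mulr_sumr -big_split -sumrB /=; apply: eq_bigr => j _; ring.
rewrite -!big_distrlr /= expr2; ring.
Qed.
End CauchySchwarz.

Section Contractions.
Variable R : realType.
Local Notation C := R[i].

Definition sqn (n : nat) (x : 'cV[C]_n) : R := \sum_i cabs (x i 0) ^+ 2.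
(** Bilinear, without conjugation: real rotations produce transposes rather than adjoints, and [dot]
    moves a matrix to the other side by transposition. *)
Definition dot (n : nat) (w x : 'cV[C]_n) : C := \sum_i w i 0 * x i 0.
Definition conjv (m n : nat) (x : 'M[C]_(m, n)) := map_mx (fun z : C => (z^*)%R) x.
Definition contr (n : nat) (M : 'M[C]_n) := forall x, sqn (M *m x) <= sqn x.

Lemma sqn_ge0 n (x : 'cV[C]_n) : 0 <= sqn x.
Proof. by apply: sumr_ge0 => i _; rewrite sqr_ge0. Qed.

Lemma dotC n (w x : 'cV[C]_n) : dot w x = dot x w.
Proof. by apply: eq_bigr => i _; rewrite mulrC. Qed.

Lemma dotE n (w x : 'cV[C]_n) : dot w x = (w^T *m x) 0 0.
Proof. by rewrite mxE; apply: eq_bigr => i _; rewrite mxE. Qed.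

Lemma dot_tr n (M : 'M[C]_n) (w x : 'cV[C]_n) : dot w (M *m x) = dot (M^T *m w) x.
Proof. by rewrite !dotE trmx_mul trmxK mulmxA. Qed.

Lemma dotDr n (w x y : 'cV[C]_n) : dot w (x + y) = dot w x + dot w y.
Proof. by rewrite !dotE mulmxDr mxE. Qed.

Lemma dotBr n (w x y : 'cV[C]_n) : dot w (x - y) = dot w x - dot w y.
Proof. by rewrite !dotE mulmxBr !mxE. Qed.

Lemma dotZr n a (w x : 'cV[C]_n) : dot w (a *: x) = a * dot w x.
Proof. by rewrite !dotE -scalemxAr mxE. Qed.

Lemma dot_sumr n (I : Type) (r : seq I) (Q : pred I) (w : 'cV[C]_n) F :
  dot w (\sum_(i <- r | Q i) F i) = \sum_(i <- r | Q i) dot w (F i).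
Proof.
rewrite dotE mulmx_sumr summxE.
by apply: eq_bigr => i _; rewrite dotE.
Qed.

Lemma innerE n (x y : 'cV[C]_n) : inner x y = dot (conjv y) x.
Proof. by rewrite /inner dotE. Qed.

Lemma conjvK m n (x : 'M[C]_(m, n)) : conjv (conjv x) = x.
Proof. by apply/matrixP => i j; rewrite !mxE conjCK. Qed.

Lemma conjvM m n p (x : 'M[C]_(m, n)) (y : 'M[C]_(n, p)) :
  conjv (x *m y) = conjv x *m conjv y.
Proof. exact: map_mxM. Qed.

Lemma sqn_conj n (x : 'cV[C]_n) : sqn (conjv x) = sqn x.
Proof. by apply: eq_bigr => i _; rewrite mxE cabsJ. Qed.

Lemma conj_dot n (w x : 'cV[C]_n) : (dot w x)^* = dot (conjv w) (conjv x).
Proof.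
rewrite /dot rmorph_sum; apply: eq_bigr => i _.
by rewrite rmorphM !mxE.
Qed.

Lemma sqn_dot n (x : 'cV[C]_n) : dot (conjv x) x = (sqn x)%:C.
Proof.
rewrite /sqn rmorph_sum; apply: eq_bigr => i _.
by rewrite mxE mulrC mulcJ.
Qed.

Lemma sqn_inner n (x : 'cV[C]_n) : inner x x = (sqn x)%:C.
Proof. by rewrite innerE sqn_dot. Qed.

Lemma dot_CS n (w x : 'cV[C]_n) : cabs (dot w x) ^+ 2 <= sqn w * sqn x.
Proof.
apply: le_trans (sum_Cauchy_Schwarz _ _).
rewrite lerXn2r ?nnegrE ?cabs_ge0 ?(le_trans (cabs_ge0 _) (cabs_sum _ _ _))//.
  by apply: sumr_ge0 => i _; rewrite mulr_ge0 ?cabs_ge0.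
apply: le_trans (cabs_sum _ _ _) _.
by apply: ler_sum => i _; rewrite cabsM.
Qed.

Lemma cabs_dot_le1 n (w x : 'cV[C]_n) : sqn w <= 1 -> sqn x <= 1 -> cabs (dot w x) <= 1.
Proof.
move=> hw hx; rewrite -(@ler_pXn2r _ 2) ?nnegrE ?cabs_ge0 ?ler01//.
rewrite expr1n (le_trans (dot_CS _ _))// -[1]mulr1.
by rewrite ler_pM ?sqn_ge0.
Qed.

Lemma sqnZ n a (x : 'cV[C]_n) : sqn (a *: x) = cabs a ^+ 2 * sqn x.
Proof.
by rewrite /sqn mulr_sumr; apply: eq_bigr => i _; rewrite mxE cabsM exprMn.
Qed.

Lemma contrM n (M1 M2 : 'M[C]_n) : contr M1 -> contr M2 -> contr (M1 *m M2).
Proof. by move=> h1 h2 x; rewrite -mulmxA (le_trans (h1 _)). Qed.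

Lemma contr1 n : @contr n 1%:M.
Proof. by move=> x; rewrite mul1mx. Qed.

Lemma contr_sqn n (M : 'M[C]_n) x : contr M -> sqn x <= 1 -> sqn (M *m x) <= 1.
Proof. by move=> h; exact: le_trans (h x). Qed.

(** With [z] the conjugate of [M^T x], [|M^T x|^2 = |x^T M z| <= |x| |M z| <= |x| |z|], and
    [|z| = |M^T x|] cancels unless it is 0. *)
Lemma contr_tr n (M : 'M[C]_n) : contr M -> contr M^T.
Proof.
move=> h x; set z := conjv (M^T *m x).
have e : sqn (M^T *m x) = cabs (dot (M *m z) x).
  by rewrite dotC dot_tr dotC sqn_dot cabs_real ger0_norm// sqn_ge0.
have := dot_CS (M *m z) x; rewrite -e => hh.
have hz : sqn (M *m z) <= sqn (M^T *m x) by rewrite -[leRHS]sqn_conj h.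
have {}hh : sqn (M^T *m x) ^+ 2 <= sqn (M^T *m x) * sqn x.
  by apply: le_trans hh _; rewrite ler_wpM2r ?sqn_ge0.
have := sqn_ge0 (M^T *m x); rewrite le_eqVlt => /orP[/eqP <-|p].
  exact: sqn_ge0.
by move: hh; rewrite expr2 ler_pM2l.
Qed.

Lemma contr_conj n (M : 'M[C]_n) : contr M -> contr (conjv M).
Proof.
by move=> h x; rewrite -[x]conjvK -conjvM sqn_conj sqn_conj; exact: h.
Qed.

Lemma contr_adj n (M : 'M[C]_n) : contr M -> contr (mxadj M).
Proof. by move=> h; exact/contr_tr/contr_conj. Qed.

Lemma mxadjM m n p (x : 'M[C]_(m, n)) (y : 'M[C]_(n, p)) :
  mxadj (x *m y) = mxadj y *m mxadj x.
Proof. by rewrite /mxadj map_mxM trmx_mul. Qed.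

Lemma mxadjK m n (x : 'M[C]_(m, n)) : mxadj (mxadj x) = x.
Proof. by apply/matrixP => i j; rewrite !mxE conjCK. Qed.

Lemma inner_adj n (M : 'M[C]_n) x y : inner (M *m x) y = inner x (mxadj M *m y).
Proof. by rewrite /inner mxadjM mxadjK mulmxA. Qed.

Lemma unitary_contr n (U : 'M[C]_n) : unitary U -> contr U.
Proof.
move=> hU x; suff -> : sqn (U *m x) = sqn x by [].
apply: (@complexI R); rewrite -!sqn_inner inner_adj mulmxA (hU) mul1mx.
by [].
Qed.

Lemma unitary_mulVr n (U : 'M[C]_n) : unitary U -> U *m mxadj U = 1%:M.
Proof. exact: mulmx1C. Qed.

Definition stdvec n (l : 'I_n) : 'cV[C]_n := delta_mx l 0.

Lemma sqn_stdvec n (l : 'I_n) : sqn (stdvec l) = 1.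
Proof.
rewrite /sqn (bigD1 l)//= mxE !eqxx cabs1 expr1n big1 ?addr0// => i il.
by rewrite mxE (negPf il) cabs0 expr0n.
Qed.

Lemma dot_stdvec n (M : 'M[C]_n) k l : dot (stdvec k) (M *m stdvec l) = M k l.
Proof.
rewrite dotE /stdvec trmx_delta -rowE -colE.
by rewrite !mxE.
Qed.

Lemma trace_dot n (M : 'M[C]_n) : \tr M = \sum_l dot (stdvec l) (M *m stdvec l).
Proof. by apply: eq_bigr => l _; rewrite dot_stdvec. Qed.

Lemma cabs_trace_contr n (M : 'M[C]_n) : contr M -> cabs (\tr M) <= n%:R.
Proof.
move=> h; rewrite trace_dot (le_trans (cabs_sum _ _ _))//.
rewrite -[n in leRHS]card_ord -sumr_const ler_sum// => l _.
by apply: cabs_dot_le1; rewrite ?contr_sqn// sqn_stdvec.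
Qed.

Lemma ntr_contr n (M : 'M[C]_n.+1) : contr M -> cabs (ntr M) <= 1.
Proof.
move=> h; rewrite /ntr cabsM cabsV cabs_nat ler_pdivrMr ?ltr0n// mul1r.
exact: cabs_trace_contr.
Qed.

End Contractions.

(** * The loop equation for a fixed unitary *)

Section Words.
Variables (R : realType) (n : nat).
Local Notation C := R[i].
Local Notation elt := (bool * 'M[C]_n)%type.

Definition letter (Z : 'M[C]_n) (e : elt) := if e.1 then Z *m e.2 *m mxadj Z else e.2.
Definition mword (Z : 'M[C]_n) (es : seq elt) :=
  foldr (fun e acc => letter Z e *m acc) 1%:M es.

Lemma mword_cat Z es1 es2 : mword Z (es1 ++ es2) = mword Z es1 *m mword Z es2.
Proof. by elim: es1 => [|e es1 IH] /=; rewrite ?mul1mx// IH mulmxA. Qed.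

Definition contrs (es : seq elt) := forall e, e \in es -> contr e.2.

Lemma contrs_cons e es : contrs (e :: es) <-> contr e.2 /\ contrs es.
Proof.
split=> [h|[h1 h2] f]; last by rewrite inE => /orP[/eqP->//|/h2].
by split; [apply: h; rewrite mem_head | move=> f hf; apply: h; rewrite inE hf orbT].
Qed.

Lemma contrs_sub es es' : {subset es <= es'} -> contrs es' -> contrs es.
Proof. by move=> s h e /s/h. Qed.

Lemma contr_letter Z e : unitary Z -> contr e.2 -> contr (letter Z e).
Proof.
rewrite /letter => hZ he; case: e.1 => //.
by apply: contrM; [apply: contrM => //|apply: contr_adj]; exact: unitary_contr.
Qed.

Lemma contr_mword Z es : unitary Z -> contrs es -> contr (mword Z es).
Proof.
move=> hZ; elim: es => [_|e es IH]; first exact: contr1.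
move=> /contrs_cons[h1 h2] /=; apply: contrM; [exact: contr_letter|exact: IH].
Qed.

(** Infinitesimal generator of the rotations in the [(i, j)] coordinate plane; it is 0 when
    [i = j]. *)
Definition rotgen (i j : 'I_n) : 'M[C]_n := delta_mx i j - delta_mx j i.

(** Derivative of [mword] when [Z] moves in the direction [X Z] with [X^* = - X]: each letter
    [Z a Z^*] contributes its commutator with [X], the other letters are constant. *)
Fixpoint dword (X Z : 'M[C]_n) (es : seq elt) : 'M[C]_n :=
  if es is e :: es' then
    (if e.1 then X *m letter Z e - letter Z e *m X else 0) *m mword Z es'
    + letter Z e *m dword X Z es'
  else 0.

(** Leibniz rule with each commutator split: [X] is inserted just before and just after every
    B-letter, so the matrices to the left of [X] are prefixes of the word. *)
Lemma dwordE X Z es : dword X Z es =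
  \sum_(l < size es) if (nth (false, 0) es l).1 then
     mword Z (take l es) *m X *m (letter Z (nth (false, 0) es l) *m mword Z (drop l.+1 es))
     - mword Z (take l.+1 es) *m X *m mword Z (drop l.+1 es) else 0.
Proof.
elim: es => [|e es IH]; first by rewrite big_ord0.
rewrite big_ord_recl /= take0 drop0 mul1mx mulmx1; congr +%R.
  by case: e.1; [rewrite mulmxBl mulmxA|exact: mul0mx].
rewrite IH mulmx_sumr; apply: eq_bigr => i _; rewrite /bump /= add1n.
by case: (nth _ _ _).1; [rewrite mulmxBr !mulmxA|exact: mulmx0].
Qed.

Lemma rotgen_mul i j (z : 'cV[C]_n) k :
  (rotgen i j *m z) k 0 = (k == i)%:R * z j 0 - (k == j)%:R * z i 0.
Proof.
have e a b : (delta_mx a b *m z) k 0 = (k == a)%:R * z b 0.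
  rewrite !mxE (bigD1 b)//= mxE eqxx andbT big1 ?addr0// => l lb.
  by rewrite mxE (negPf lb) andbF mul0r.
by rewrite mulmxBl mxE [X in _ + X]mxE !e.
Qed.

Lemma mul_rotgen m (P : 'M[C]_(m, n)) i j (z : 'cV[C]_n) k :
  (P *m rotgen i j *m z) k 0 = P k i * z j 0 - P k j * z i 0.
Proof.
rewrite -mulmxA mxE.
under eq_bigr do rewrite rotgen_mul mulrBr.
rewrite sumrB; congr (_ - _).
  rewrite (bigD1 i)//= eqxx mul1r big1 ?addr0// => l /negPf ->.
  by rewrite mul0r mulr0.
rewrite (bigD1 j)//= eqxx mul1r big1 ?addr0// => l /negPf ->.
by rewrite mul0r mulr0.
Qed.

(** The two halves of the antisymmetric generator behave differently: one closes the indices of [P]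
    into a trace, possibly of order n, the other leaves a bilinear form, bounded for
    contractions. *)
Lemma sum_mul_rotgen (P : 'M[C]_n) (w z : 'cV[C]_n) :
  \sum_i \sum_j (P *m rotgen i j *m z) i 0 * w j 0 = \tr P * dot w z - dot z (P *m w).
Proof.
under eq_bigr => i _ do under eq_bigr => j _ do rewrite mul_rotgen mulrBl.
under eq_bigr do rewrite sumrB.
rewrite sumrB /mxtrace /dot big_distrlr /=; congr (_ - _).
  by apply: eq_bigr => i _; apply: eq_bigr => j _; ring.
apply: eq_bigr => i _; rewrite mxE mulr_sumr.
by apply: eq_bigr => j _; ring.
Qed.

(** No index closes into a trace here, so the terms coming from the derivative of [g(psi)] stay
    bounded in the dimension. *)
Lemma sum_dot_rotgen (p w u z : 'cV[C]_n) :
  \sum_i \sum_j p i 0 * w j 0 * dot u (rotgen i j *m z) =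
  dot u p * dot w z - dot p z * dot w u.
Proof.
have e i j : dot u (rotgen i j *m z) = u i 0 * z j 0 - u j 0 * z i 0.
  by rewrite dotE mulmxA mul_rotgen !mxE.
under eq_bigr => i _ do under eq_bigr => j _ do rewrite e mulrBr.
under eq_bigr do rewrite sumrB.
rewrite sumrB /dot !big_distrlr /=; congr (_ - _).
  by apply: eq_bigr => i _; apply: eq_bigr => j _; ring.
by apply: eq_bigr => i _; apply: eq_bigr => j _; ring.
Qed.

Lemma conjv_rotgen i j : conjv (rotgen i j) = rotgen i j.
Proof. by apply/matrixP => k l; rewrite !mxE rmorphB /= !rmorph_nat. Qed.

End Words.

Section Loop.
Variables (R : realType) (n' : nat).
Local Notation n := n'.+1.
Local Notation C := R[i].
Local Notation elt := (bool * 'M[C]_n)%type.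
Variables (Z : 'M[C]_n) (es : seq elt) (w x : 'cV[C]_n).
Hypotheses (hZ : unitary Z) (hes : contrs es) (hw : sqn w <= 1) (hx : sqn x <= 1).

Let W := mword Z es.
Let psi := dot w (W *m x).
Let D i j := dword (rotgen _ i j) Z es *m x.
Let r := size es.

(* For l = 0 the prefix is empty: its trace is the leading term, left out here. *)
Definition loop_term (l : nat) : R :=
  (if (nth (false, 0) es l).1 then
     (if l is 0 then 0 else cabs (ntr (mword Z (take l es)))) +
     cabs (ntr (mword Z (take l.+1 es))) else 0).

Let P l := mword Z (take l es).
Let S l := mword Z (drop l.+1 es) *m x.
Let m l := letter Z (nth (false, 0) es l).
Let b l := (nth (false, 0) es l).1.

Let DE i j : D i j = \sum_(l < r) if b l then
  P l *m rotgen _ i j *m (m l *m S l) - P l.+1 *m rotgen _ i j *m S l else 0.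
Proof.
rewrite /D dwordE mulmx_suml; apply: eq_bigr => l _.
rewrite /b; case: (nth _ es l).1; last exact: mul0mx.
by rewrite mulmxBl -mulmxA -[in X in _ - X]mulmxA; congr (_ - _); rewrite !mulmxA.
Qed.

Let hP l : contr (P l).
Proof. by apply: contr_mword => //; apply: contrs_sub hes => e; exact: mem_take. Qed.

Let hS l : sqn (S l) <= 1.
Proof.
apply: contr_sqn => //; apply: contr_mword => //.
by apply: contrs_sub hes => e; exact: mem_drop.
Qed.

Let hm l : (l < r)%N -> contr (m l).
Proof. by move=> lr; apply: contr_letter => //; apply: hes; rewrite mem_nth. Qed.

Let hmS l : (l < r)%N -> sqn (m l *m S l) <= 1.
Proof. by move=> lr; apply: contr_sqn; [exact: hm|exact: hS]. Qed.

Let ntrE (M : 'M[C]_n) : \tr M = n%:R * ntr M.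
Proof. by rewrite /ntr mulrC divfK// pnatr_eq0. Qed.

Let ind_le1 (c d e : C) (k : R) : cabs c <= k -> cabs d <= 1 -> cabs e <= 1 ->
  cabs (c * d - e) <= k + 1.
Proof.
move=> hc hd he; apply: le_trans (cabsB _ _) _; apply: lerD => //.
by rewrite cabsM -[k]mulr1 ler_pM ?cabs_ge0.
Qed.

(** The insertion before the first letter has an empty prefix, of trace n, and restores the whole
    word: it is [n psi]. Every other insertion costs n times a normalised prefix trace. The bilinear
    remainders, at most two per letter and each of modulus at most 1, give [2 r]. *)
Lemma loop_main : (0 < r)%N -> (nth (false, 0) es 0).1 ->
  cabs (\sum_i \sum_j D i j i 0 * w j 0 - n%:R * psi) <=
  n%:R * (\sum_(l < r) loop_term l) + 2 * r%:R.
Proof.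
move=> r0 b0.
have -> : \sum_i \sum_j D i j i 0 * w j 0 = \sum_(l < r) if b l then
   (\tr (P l) * dot w (m l *m S l) - dot (m l *m S l) (P l *m w))
   - (\tr (P l.+1) * dot w (S l) - dot (S l) (P l.+1 *m w)) else 0.
  transitivity (\sum_(l < r) \sum_i \sum_j (if b l then
     (P l *m rotgen _ i j *m (m l *m S l)) i 0 * w j 0
     - (P l.+1 *m rotgen _ i j *m S l) i 0 * w j 0 else 0)).
    rewrite [RHS]exchange_big /=; apply: eq_bigr => i _.
    rewrite [RHS]exchange_big /=; apply: eq_bigr => j _.
    rewrite DE summxE mulr_suml; apply: eq_bigr => l _.
    by case: ifP => _; rewrite mxE ?mul0r// [X in _ + X]mxE mulrBl.
  apply: eq_bigr => l _; case: ifP => _; last by rewrite !big1// => i _; rewrite big1.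
  under eq_bigr do rewrite sumrB.
  by rewrite sumrB !sum_mul_rotgen.
have hpsi : n%:R * psi = \sum_(l < r) (if l == 0%N :> nat then n%:R * psi else 0).
  case: r r0 => // r' _; rewrite big_ord_recl /= big1 ?addr0//.
rewrite hpsi -sumrB (le_trans (cabs_sum _ _ _))//.
have -> : 2 * r%:R = \sum_(l < r) (2 : R).
  by rewrite sumr_const card_ord mulr_natr.
rewrite [X in _ <= X + _]mulr_sumr -big_split /=; apply: ler_sum => -[l lr] _ /=.
rewrite /loop_term -/(b l); case: ifP => hb; last first.
  case: l lr hb => [|l] lr hb; first by rewrite /b b0 in hb.
  by rewrite subrr cabs0 mulr0 add0r.
have h1 : cabs (dot (m l *m S l) (P l *m w)) <= 1.
  by apply: cabs_dot_le1; [exact: hmS|exact: contr_sqn].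
have h2 : cabs (dot (S l) (P l.+1 *m w)) <= 1.
  by apply: cabs_dot_le1; [exact: hS|exact: contr_sqn].
have h3 : cabs (\tr (P l.+1) * dot w (S l) - dot (S l) (P l.+1 *m w)) <=
   n%:R * cabs (ntr (P l.+1)) + 1.
  apply: ind_le1 => //; first by rewrite ntrE cabsM cabs_nat.
  exact: cabs_dot_le1.
case: l lr hb h1 h2 h3 => [|l] lr hb h1 h2 h3 /=.
  have -> : \tr (P 0) * dot w (m 0 *m S 0) = n%:R * psi.
    rewrite /P take0 /= mxtrace1; congr (_ * dot _ _).
    have h (es0 : seq elt) : (0 < size es0)%N ->
        letter Z (nth (false, 0) es0 0) *m (mword Z (drop 1 es0) *m x) = mword Z es0 *m x.
      by case: es0 => //= e es' _; rewrite drop0 mulmxA.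
    exact: h.
  rewrite add0r addrAC -addrA addrC.
  apply: (@le_trans _ _ (cabs (\tr (P 1) * dot w (S 0) - dot (S 0) (P 1 *m w)) +
     cabs (dot (m 0 *m S 0) (P 0 *m w)))).
    set u := dot _ (P 0 *m w); set v := (_ - dot (S 0) _).
    have -> : - (n%:R * psi) - v + (n%:R * psi - u) = - (v + u) by ring.
    by rewrite cabsN cabsD.
  rewrite /P in h3 h1 *; lra.
rewrite subr0; apply: le_trans (cabsB _ _) _.
apply: le_trans (lerD _ h3) _.
  apply: (@ind_le1 _ _ _ (n%:R * cabs (ntr (P l.+1)))) => //.
    by rewrite ntrE cabsM cabs_nat.
  by apply: cabs_dot_le1; last exact: hmS.
by rewrite /P; lra.
Qed.

Let dotD i j : dot w (D i j) = \sum_(l < r) if b l then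
  dot ((P l)^T *m w) (rotgen _ i j *m (m l *m S l))
  - dot ((P l.+1)^T *m w) (rotgen _ i j *m S l) else 0.
Proof.
rewrite DE dot_sumr; apply: eq_bigr => l _; case: ifP => _.
  by rewrite dotBr -!dot_tr !mulmxA.
by rewrite dotE mulmx0 mxE.
Qed.

Let cross_le (p u z : 'cV[C]_n) : sqn p <= 1 -> sqn u <= 1 -> sqn z <= 1 ->
  cabs (\sum_i \sum_j p i 0 * w j 0 * dot u (rotgen _ i j *m z)) <= 2.
Proof.
move=> hp hu hz; rewrite sum_dot_rotgen (_ : 2 = 1 + 1)//.
by apply: ind_le1; rewrite ?cabsM ?mulr_ile1 ?cabs_ge0 ?cabs_dot_le1.
Qed.

(** Each B-letter gives two insertions, each evaluated by [sum_dot_rotgen] to a difference of two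
    products of modulus at most 1, whence 4 per letter. The conjugate sum has the same shape because
    the generators are real. It is used with [p = W x]. *)
Lemma loop_cross (p : 'cV[C]_n) : sqn p <= 1 ->
  cabs (\sum_i \sum_j p i 0 * w j 0 * dot w (D i j)) <= 4 * r%:R /\
  cabs (\sum_i \sum_j p i 0 * w j 0 * (dot w (D i j))^*) <= 4 * r%:R.
Proof.
move=> hp.
have -> : 4 * r%:R = \sum_(l < r) (4 : R).
  by rewrite sumr_const card_ord mulr_natr.
split.
  rewrite (_ : \sum_i _ = \sum_(l < r) \sum_i \sum_j p i 0 * w j 0 * (if b l then
      dot ((P l)^T *m w) (rotgen _ i j *m (m l *m S l))
      - dot ((P l.+1)^T *m w) (rotgen _ i j *m S l) else 0)); last first.
    rewrite [RHS]exchange_big /=; apply: eq_bigr => i _.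
    rewrite [RHS]exchange_big /=; apply: eq_bigr => j _.
    by rewrite dotD mulr_sumr.
  apply: le_trans (cabs_sum _ _ _) _; apply: ler_sum => -[l lr] _ /=.
  case: (b l); last first.
    by rewrite !big1 ?cabs0// => i _; rewrite big1// => j _; rewrite mulr0.
  under eq_bigr => i _ do under eq_bigr => j _ do rewrite mulrBr.
  rewrite (_ : 4 = 2 + 2); last by lra.
  under eq_bigr do rewrite sumrB.
  rewrite sumrB (le_trans (cabsB _ _))// lerD//; apply: cross_le => //.
  - by apply: contr_sqn => //; exact: contr_tr.
  - exact: hmS.
  - by apply: contr_sqn => //; exact: contr_tr.
rewrite (_ : \sum_i _ = \sum_(l < r) \sum_i \sum_j p i 0 * w j 0 * (if b l then
      dot (conjv ((P l)^T *m w)) (rotgen _ i j *m conjv (m l *m S l))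
      - dot (conjv ((P l.+1)^T *m w)) (rotgen _ i j *m conjv (S l)) else 0)); last first.
  rewrite [RHS]exchange_big /=; apply: eq_bigr => i _.
  rewrite [RHS]exchange_big /=; apply: eq_bigr => j _.
  rewrite dotD rmorph_sum mulr_sumr; apply: eq_bigr => l _; congr (_ * _).
  case: (b l); last exact: conjC0.
  by rewrite rmorphB /= !conj_dot !conjvM conjv_rotgen.
apply: le_trans (cabs_sum _ _ _) _; apply: ler_sum => -[l lr] _ /=.
case: (b l); last first.
  by rewrite !big1 ?cabs0// => i _; rewrite big1// => j _; rewrite mulr0.
under eq_bigr => i _ do under eq_bigr => j _ do rewrite mulrBr.
rewrite (_ : 4 = 2 + 2); last by lra.
under eq_bigr do rewrite sumrB.
rewrite sumrB (le_trans (cabsB _ _))// lerD//; apply: cross_le; rewrite ?sqn_conj//.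
- by apply: contr_sqn => //; exact: contr_tr.
- exact: hmS.
- by apply: contr_sqn => //; exact: contr_tr.
Qed.

(** Derivative at the identity, along the rotation in the plane [(i, j)], of
    [(W x)_i w_j conj(psi)^2 psi]. *)
Definition loop_deriv i j : C :=
  D i j i 0 * w j 0 * (psi^* ^+ 2 * psi)
  + (W *m x) i 0 * w j 0 *
     (2%:R * psi^* * (dot w (D i j))^* * psi + psi^* ^+ 2 * dot w (D i j)).

(** Multiplying [n psi] by [conj(psi)^2 psi] gives [n |psi|^4]. The constant is [14 = 2 + 8 + 4]:
    the bounded errors of [loop_main], lowered from cubic to quadratic by [|psi| <= 1], then the
    derivatives of [conj(psi)^2] and of [psi]. *)
Lemma loop_pointwise : (0 < r)%N -> (nth (false, 0) es 0).1 ->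
  n%:R * cabs psi ^+ 4 <= complex.Re (\sum_i \sum_j loop_deriv i j)
   + n%:R * (\sum_(l < r) loop_term l) * cabs psi ^+ 3 + 14 * r%:R * cabs psi ^+ 2.
Proof.
move=> r0 b0; have hM := loop_main r0 b0.
have hWx : sqn (W *m x) <= 1 by apply: contr_sqn => //; exact: contr_mword.
have hpsi : cabs psi <= 1 by apply: cabs_dot_le1.
have [hc1 hc2] := loop_cross hWx.
pose S1 := \sum_i \sum_j D i j i 0 * w j 0.
pose S2 := \sum_i \sum_j (W *m x) i 0 * w j 0 * dot w (D i j).
pose S3 := \sum_i \sum_j (W *m x) i 0 * w j 0 * (dot w (D i j))^*.
have -> : \sum_i \sum_j loop_deriv i j = S1 * (psi^* ^+ 2 * psi) +
   (S3 * (2%:R * psi^* * psi) + S2 * psi^* ^+ 2).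
  rewrite /S1 /S2 /S3 !mulr_suml -!big_split /=; apply: eq_bigr => i _.
  rewrite !mulr_suml -!big_split /=; apply: eq_bigr => j _.
  by rewrite /loop_deriv; ring.
rewrite -/S1 in hM; rewrite -/S2 in hc1; rewrite -/S3 in hc2.
have e1 : complex.Re (n%:R * psi * (psi^* ^+ 2 * psi)) = n%:R * cabs psi ^+ 4.
  have -> : n%:R * psi * (psi^* ^+ 2 * psi) = n%:R * ((psi * psi^*) ^+ 2) by ring.
  rewrite mulcJ -rmorphXn -(rmorph_nat (real_complex R)) -rmorphM /=.
  by ring.
set Q := (X in complex.Re X).
have e2 : n%:R * psi * (psi^* ^+ 2 * psi) = Q - ((S1 - n%:R * psi) * (psi^* ^+ 2 * psi) +
   (S3 * (2%:R * psi^* * psi) + S2 * psi^* ^+ 2)) by rewrite /Q; ring.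
rewrite -e1 e2 cReD -addrA lerD2l.
apply: le_trans (Re_le_cabs _) _; rewrite cabsN.
apply: le_trans (cabsD _ _) _.
apply: le_trans (lerD _ (cabsD _ _)) _; first by rewrite cabsM.
have hq : cabs psi ^+ 3 <= cabs psi ^+ 2.
  by rewrite exprS ler_piMl ?exprn_ge0 ?cabs_ge0.
rewrite !cabsM ?cabsX !cabsJ cabs_nat.
set q := cabs psi in hpsi hq *.
have q0 : 0 <= q by exact: cabs_ge0.
have t1 := ler_wpM2r (exprn_ge0 3 q0) hM.
have t2 := ler_wpM2r (exprn_ge0 2 q0) hc1.
have t3 := ler_wpM2r (exprn_ge0 2 q0) hc2.
have t4 : 2 * r%:R * q ^+ 3 <= 2 * r%:R * q ^+ 2 by rewrite ler_wpM2l.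
rewrite -mulrA -[2 * q * q]mulrA -!expr2 -exprS [cabs S3 * _]mulrCA.
rewrite mulrDl in t1.
lra.
Qed.

End Loop.

(** * First-order expansions along rotations *)

Section Expansion.
Variables (R : realType) (T : Type).
Local Notation C := R[i].

(** The remainder is uniform in the sample point and the coefficients are bounded. This makes the
    notion stable under products and lets an expansion be integrated term by term, without a theorem
    on differentiation under the integral. *)
Definition taylor1 (f : R -> T -> C) (f0 f1 : T -> C) :=
  exists K : R, forall t w, 0 <= t <= 1 ->
   [/\ cabs (f t w - f0 w - t%:C * f1 w) <= K * t ^+ 2, cabs (f0 w) <= K
     & cabs (f1 w) <= K].

Lemma taylor1_cst (f : T -> C) (K : R) : (forall w, cabs (f w) <= K) ->
  taylor1 (fun _ => f) f (fun _ => 0).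
Proof.
move=> h; exists K => t w _.
have K0 : 0 <= K by exact: le_trans (cabs_ge0 _) (h w).
by rewrite mulr0 subrr subr0 cabs0 mulr_ge0 ?sqr_ge0.
Qed.

Lemma taylor1_eq f f0 f1 g g0 g1 : taylor1 f f0 f1 ->
  (forall t w, f t w = g t w) -> (forall w, f0 w = g0 w) -> (forall w, f1 w = g1 w) ->
  taylor1 g g0 g1.
Proof.
by move=> [K hK] e e0 e1; exists K => t w ht; rewrite -e -e0 -e1; exact: hK.
Qed.

Lemma taylor1D f f0 f1 g g0 g1 : taylor1 f f0 f1 -> taylor1 g g0 g1 ->
  taylor1 (fun t w => f t w + g t w) (fun w => f0 w + g0 w) (fun w => f1 w + g1 w).
Proof.
move=> [K hK] [L hL]; exists (K + L) => t w ht.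
have [a b c] := hK t w ht; have [a' b' c'] := hL t w ht.
split; [|exact: le_trans (cabsD _ _) (lerD _ _)|exact: le_trans (cabsD _ _) (lerD _ _)].
rewrite mulrDl; apply: le_trans (lerD a a').
apply: le_trans (cabsD _ _); rewrite le_eqVlt; apply/orP; left; apply/eqP.
by congr cabs; ring.
Qed.

Lemma taylor1M f f0 f1 g g0 g1 : taylor1 f f0 f1 -> taylor1 g g0 g1 ->
  taylor1 (fun t w => f t w * g t w) (fun w => f0 w * g0 w)
    (fun w => f1 w * g0 w + f0 w * g1 w).
Proof.
(* [6 = 3 + 2 + 1]: the remainder of [f] times [g], which is at most [3 L]; the affine part of [f],
   at most [2 K], times the remainder of [g]; and the second-order term [t^2 f1 g1]. *)
move=> [K hK] [L hL]; exists (6 * K * L) => t w ht.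
have [a b c] := hK t w ht; have [a' b' c'] := hL t w ht.
have K0 : 0 <= K by exact: le_trans (cabs_ge0 _) b.
have L0 : 0 <= L by exact: le_trans (cabs_ge0 _) b'.
have KL0 : 0 <= K * L by exact: mulr_ge0.
have /andP[t0 t1] := ht.
have tt : t ^+ 2 <= 1 by rewrite exprn_ile1.
have ct : cabs t%:C = t by rewrite cabs_real ger0_norm.
set rf := f t w - _ - _ in a; set rg := g t w - _ - _ in a'.
have hm (u v : C) : cabs u <= K -> cabs v <= L -> cabs (u * v) <= K * L.
  by move=> hu hv; rewrite cabsM ler_pM ?cabs_ge0.
split.
- have -> : f t w * g t w - f0 w * g0 w - t%:C * (f1 w * g0 w + f0 w * g1 w)
     = rf * (g0 w + t%:C * g1 w + rg) + ((f0 w + t%:C * f1 w) * rg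
       + t%:C ^+ 2 * (f1 w * g1 w)) by rewrite /rf /rg; ring.
  have hg : cabs (g0 w + t%:C * g1 w + rg) <= 3 * L.
    apply: le_trans (cabsD _ _) _; apply: le_trans (lerD (cabsD _ _) (lexx _)) _.
    rewrite cabsM ct.
    have : t * cabs (g1 w) <= L by rewrite -[L]mul1r ler_pM ?cabs_ge0.
    have : cabs rg <= L by apply: le_trans a' _; rewrite ler_piMr.
    lra.
  have hf : cabs (f0 w + t%:C * f1 w) <= 2 * K.
    apply: le_trans (cabsD _ _) _; rewrite cabsM ct.
    have : t * cabs (f1 w) <= K by rewrite -[K]mul1r ler_pM ?cabs_ge0.
    lra.
  apply: le_trans (cabsD _ _) _; apply: le_trans (lerD (lexx _) (cabsD _ _)) _.
  rewrite !cabsM ct -expr2.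
  have h1 := ler_pM (cabs_ge0 _) (cabs_ge0 _) a hg.
  have h2 := ler_pM (cabs_ge0 _) (cabs_ge0 _) hf a'.
  have h3 : t ^+ 2 * (cabs (f1 w) * cabs (g1 w)) <= t ^+ 2 * (K * L).
    by rewrite ler_wpM2l ?sqr_ge0// ler_pM ?cabs_ge0.
  apply: le_trans (lerD h1 (lerD h2 h3)) _.
  rewrite le_eqVlt; apply/orP; left; apply/eqP; ring.
- by apply: le_trans (hm _ _ b b') _; lra.
- apply: le_trans (cabsD _ _) _.
  by have := hm _ _ c b'; have := hm _ _ b c'; lra.
Qed.

Lemma taylor1J f f0 f1 : taylor1 f f0 f1 ->
  taylor1 (fun t w => (f t w)^*) (fun w => (f0 w)^*) (fun w => (f1 w)^*).
Proof.
move=> [K hK]; exists K => t w ht; have [a b c] := hK t w ht.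
split; rewrite ?cabsJ//.
have -> : (f t w)^* - (f0 w)^* - t%:C * (f1 w)^* =
  (f t w - f0 w - t%:C * f1 w)^*; last by rewrite cabsJ.
rewrite !rmorphB rmorphM /=; congr (_ - _ * _).
by apply/eqP; rewrite eq_complex cReJ cImJ /= oppr0 !eqxx.
Qed.

Lemma taylor1_sum (I : Type) (r : seq I) f f0 f1 :
  (forall i : I, taylor1 (f i) (f0 i) (f1 i)) ->
  taylor1 (fun t w => \sum_(i <- r) f i t w) (fun w => \sum_(i <- r) f0 i w)
    (fun w => \sum_(i <- r) f1 i w).
Proof.
move=> h; elim: r => [|i r IH].
  apply: taylor1_eq (@taylor1_cst (fun _ => 0) 0 _) _ _ _ => *; rewrite ?big_nil//.
  by rewrite cabs0.
by apply: taylor1_eq (taylor1D (h i) IH) _ _ _ => *; rewrite big_cons.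
Qed.

Definition mtaylor1 m n (F : R -> T -> 'M[C]_(m, n)) (F0 F1 : T -> 'M[C]_(m, n)) :=
  forall i j, taylor1 (fun t w => F t w i j) (fun w => F0 w i j) (fun w => F1 w i j).

Lemma mtaylor1M m n p (F : R -> T -> 'M[C]_(m, n)) (F0 F1 : T -> 'M[C]_(m, n))
   (G : R -> T -> 'M[C]_(n, p)) (G0 G1 : T -> 'M[C]_(n, p)) : mtaylor1 F F0 F1 -> mtaylor1 G G0 G1 ->
  mtaylor1 (fun t w => F t w *m G t w) (fun w => F0 w *m G0 w)
    (fun w => F1 w *m G0 w + F0 w *m G1 w).
Proof.
move=> hF hG i j.
apply: taylor1_eq (taylor1_sum (index_enum _) (fun k => taylor1M (hF i k) (hG k j))) _ _ _.
- by move=> t w; rewrite mxE.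
- by move=> w; rewrite mxE.
- by move=> w; rewrite !mxE -big_split.
Qed.

Lemma mtaylor1J m n (F : R -> T -> 'M[C]_(m, n)) (F0 F1 : T -> 'M[C]_(m, n)) : mtaylor1 F F0 F1 ->
  mtaylor1 (fun t w => mxadj (F t w)) (fun w => mxadj (F0 w)) (fun w => mxadj (F1 w)).
Proof.
by move=> h i j; apply: taylor1_eq (taylor1J (h j i)) _ _ _ => *; rewrite !mxE.
Qed.

Lemma mtaylor1_cst m n (F : T -> 'M[C]_(m, n)) (K : R) :
  (forall w i j, cabs (F w i j) <= K) -> mtaylor1 (fun _ => F) F (fun _ => 0).
Proof.
by move=> h i j; apply: taylor1_eq (@taylor1_cst (fun w => F w i j) K _) _ _ _ => *; rewrite ?mxE.
Qed.

Lemma mtaylor1_eq m n (F : R -> T -> 'M[C]_(m, n)) (F0 F1 : T -> 'M[C]_(m, n)) G (G0 G1 : T -> 'M[C]_(m, n)) : mtaylor1 F F0 F1 ->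
  (forall t w, F t w = G t w) -> (forall w, F0 w = G0 w) -> (forall w, F1 w = G1 w) ->
  mtaylor1 G G0 G1.
Proof.
by move=> h e e0 e1 i j; apply: taylor1_eq (h i j) _ _ _ => *; rewrite ?e ?e0 ?e1.
Qed.

Lemma mtaylor1_mx m n (M : 'M[C]_(m, n)) : mtaylor1 (fun _ _ => M) (fun _ => M) (fun _ => 0).
Proof.
apply: (@mtaylor1_cst _ _ _ (\sum_i \sum_j cabs (M i j))) => _ i j.
rewrite (bigD1 i)//= (bigD1 j)//= -addrA lerDl addr_ge0//.
  by apply: sumr_ge0 => k _; exact: cabs_ge0.
by apply: sumr_ge0 => k _; apply: sumr_ge0 => l _; exact: cabs_ge0.
Qed.

End Expansion.

(** * Plane rotations and their first-order expansion *)

Section Rotation.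
Variables (R : realType) (n : nat).
Local Notation C := R[i].

Definition rcos (t : R) : R := (1 - (t / 2) ^+ 2) / (1 + (t / 2) ^+ 2).
Definition rsin (t : R) : R := t / (1 + (t / 2) ^+ 2).

Let den (t : R) : 1 + (t / 2) ^+ 2 != 0.
Proof. by have := sqr_ge0 (t / 2); move=> h; rewrite gt_eqF//; lra. Qed.

Lemma rcos2Dsin2 t : rcos t ^+ 2 + rsin t ^+ 2 = 1.
Proof. by rewrite /rcos /rsin; field; have := den t; apply: contra => /eqP h; apply/eqP; lra. Qed.

(* The Cayley parametrisation, rational in t, of the rotation of angle
   2 arctan (t / 2) in the (i, j) coordinate plane. *)
Definition rotation (i j : 'I_n) (t : R) : 'M[C]_n :=
  if i == j then 1%:M else
  1%:M + (rcos t - 1)%:C *: (delta_mx i i + delta_mx j j) + (rsin t)%:C *: rotgen R i j.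

Lemma map_conj_real_mx (M : 'M[C]_n) : real_mx M -> conjv M = M.
Proof.
move=> h; apply/matrixP => k l; rewrite !mxE; have := h k l.
by case: (M k l) => a b /= ->; rewrite conjE /= oppr0.
Qed.

Lemma rotation_real i j t : real_mx (rotation i j t).
Proof.
have hn (b : bool) : complex.Im (b%:R : C) = 0 by case: b.
move=> k l; rewrite /rotation; case: ifP => _; rewrite !mxE; first by case: (k == l).
rewrite !cImD !cImM /= !cImD !cImN !hn -mulr_natr.
by rewrite !(oppr0, mul0r, mulr0, addr0, add0r, subr0, hn).
Qed.

(** For [i != j], [P] is the projection on the coordinate plane, [X] vanishes off it and
    [X^2 = - P]. With [a] the cosine minus 1 and [s] the sine, the product is
    [1 + (2 a + a^2 + s^2) P], and this coefficient is 0. *)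
Lemma rotation_unitary i j t : unitary (rotation i j t).
Proof.
rewrite /unitary; have -> : mxadj (rotation i j t) = (rotation i j t)^T.
  by rewrite /mxadj; congr trmx; exact/map_conj_real_mx/rotation_real.
rewrite /rotation; case: eqVneq => [_|ij]; first by rewrite trmx1 mul1mx.
set a := (_ - 1)%:C; set s := (rsin t)%:C.
have -> : (1%:M + a *: (delta_mx i i + delta_mx j j) + s *: rotgen R i j)^T =
   1%:M + a *: (delta_mx i i + delta_mx j j) - s *: rotgen R i j.
  apply/matrixP => k l; rewrite !mxE (eq_sym l k) ![(l == _) && _]andbC.
  by rewrite -mulrN opprB.
have ji : (j == i) = false by rewrite eq_sym (negPf ij).
set P := _ + delta_mx j j; set X := rotgen R i j.
pose simp := (mulr1n, mulr0n, subr0, sub0r, addr0, add0r, opprB, opprK, oppr0).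
have PP : P *m P = P.
  by rewrite /P mulmxDl !mulmxDr !mul_delta_mx_cond !eqxx ji (negPf ij) !simp.
have PX : P *m X = X.
  by rewrite /P /X mulmxDl !mulmxBr !mul_delta_mx_cond !eqxx ji (negPf ij) !simp.
have XP : X *m P = X.
  by rewrite /P /X mulmxDr !mulmxBl !mul_delta_mx_cond !eqxx ji (negPf ij) !simp addrC.
have XX : X *m X = - P.
  rewrite /P /X mulmxBl !mulmxBr !mul_delta_mx_cond !eqxx ji (negPf ij) !simp.
  by rewrite opprD.
rewrite !(mulmxDl, mulmxDr, mul1mx, mulmx1, mulNmx, mulmxN) -!scalemxAl -!scalemxAr.
rewrite PP PX XP XX.
have e : a + a + a * a + s * s = 0.
  rewrite /a /s -!rmorphM -!rmorphD /= -[RHS]/(0%:C); congr _%:C.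
  by have := rcos2Dsin2 t; rewrite !expr2; lra.
apply/matrixP => k l; move: e P X {PP PX XP XX}; clear => e P X; rewrite !mxE.
move: (P k l) (X k l) (_%:R) => p x u.
transitivity (u + (a + a + a * a + s * s) * p); last by rewrite e mul0r addr0.
ring.
Qed.

Let rsinE t : rsin t - t = - (t * (t / 2) ^+ 2 / (1 + (t / 2) ^+ 2)).
Proof. by rewrite /rsin; field; have := den t; apply: contra => /eqP h; apply/eqP; lra. Qed.

Let rcosE t : rcos t - 1 = - (2 * (t / 2) ^+ 2 / (1 + (t / 2) ^+ 2)).
Proof. by rewrite /rcos; field; have := den t; apply: contra => /eqP h; apply/eqP; lra. Qed.

Let div_le (u t : R) : 0 <= u -> u / (1 + (t / 2) ^+ 2) <= u.
Proof.
move=> u0; have h := sqr_ge0 (t / 2).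
by rewrite ler_pdivrMr ?ler_peMr//; lra.
Qed.

Lemma rotation_taylor1 (T : Type) i j :
  mtaylor1 (fun t (_ : T) => rotation i j t) (fun _ => 1%:M) (fun _ => rotgen R i j).
Proof.
case: (eqVneq i j) => [<-|ij].
  apply: mtaylor1_eq (mtaylor1_mx T (1%:M)) _ _ _ => // [t _|_].
    by rewrite /rotation eqxx.
  by rewrite /rotgen subrr.
have hc : taylor1 (fun t (_ : T) => (rcos t - 1)%:C) (fun _ => 0) (fun _ => 0).
  exists 1 => t _ /andP[t0 t1]; split; rewrite ?cabs0 ?ler01//.
  rewrite mulr0 !subr0 cabs_real rcosE normrN ger0_norm; last first.
    by rewrite divr_ge0 ?mulr_ge0 ?addr_ge0 ?sqr_ge0.
  apply: le_trans (div_le _ _) _; first by rewrite mulr_ge0 ?sqr_ge0.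
  by rewrite exprMn mul1r; have := sqr_ge0 t; lra.
have hs : taylor1 (fun t (_ : T) => (rsin t)%:C) (fun _ => 0) (fun _ => 1).
  exists 1 => t _ /andP[t0 t1]; split; rewrite ?cabs0 ?cabs1 ?ler01//.
  rewrite mulr1 subr0 -rmorphB cabs_real rsinE normrN ger0_norm; last first.
    by rewrite divr_ge0 ?mulr_ge0 ?addr_ge0 ?sqr_ge0.
  apply: le_trans (div_le _ _) _; first by rewrite mulr_ge0 ?sqr_ge0.
  have h2 := sqr_ge0 t; rewrite exprMn mul1r.
  have : t * t ^+ 2 <= t ^+ 2 by rewrite ler_piMl.
  by rewrite mulrCA mulrA mulrC; lra.
move=> k l.
have hcst (c : C) : taylor1 (fun _ (_ : T) => c) (fun _ => c) (fun _ => 0).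
  exact: (@taylor1_cst _ _ _ (cabs c)).
have h := taylor1D (taylor1D (hcst (1%:M k l)) (taylor1M hc (hcst ((delta_mx i i + delta_mx j j : 'M[C]_n) k l))))
   (taylor1M hs (hcst (rotgen R i j k l))).
apply: taylor1_eq h _ _ _ => [t _|_|_].
- by rewrite /rotation (negPf ij) [RHS]mxE [X in _ = X + _]mxE [X in _ = _ + X + _]mxE [X in _ = _ + X]mxE.
- by rewrite !mul0r !addr0.
- by rewrite !(mul0r, mulr0, addr0, add0r, mul1r).
Qed.

End Rotation.

(** * Expansion of words and of the loop observable along a rotation *)

Section WordExpansion.
Variables (R : realType) (n : nat) (T : Type) (U : T -> 'M[R[i]]_n).
Hypothesis hU : forall w, unitary (U w).
Local Notation C := R[i].

Lemma unitary_entry (V : 'M[C]_n) i j : unitary V -> cabs (V i j) <= 1.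
Proof.
move=> hV; rewrite -dot_stdvec; apply: cabs_dot_le1; rewrite ?sqn_stdvec//.
by apply: contr_sqn; rewrite ?sqn_stdvec//; exact: unitary_contr.
Qed.

Lemma mword_taylor1 i j es :
  mtaylor1 (fun t w => mword (rotation i j t *m U w) es) (fun w => mword (U w) es)
    (fun w => dword (rotgen R i j) (U w) es).
Proof.
have hUt : mtaylor1 (fun _ => U) U (fun _ => 0).
  by apply: (@mtaylor1_cst _ _ _ _ _ 1) => w k l; exact: unitary_entry.
have hV := mtaylor1M (@rotation_taylor1 R n T i j) hUt.
elim: es => [|e es IH]; first exact: mtaylor1_mx.
suff he : mtaylor1 (fun t w => letter (rotation i j t *m U w) e) (fun w => letter (U w) e)
    (fun w => if e.1 then rotgen R i j *m letter (U w) e - letter (U w) e *m rotgen R i j else 0).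
  exact: mtaylor1M he IH.
rewrite /letter; case: e.1; last exact: mtaylor1_mx.
apply: mtaylor1_eq (mtaylor1M (mtaylor1M hV (mtaylor1_mx T e.2)) (mtaylor1J hV)) _ _ _ => //.
  by move=> w; rewrite mul1mx.
move=> w; rewrite !mulmx0 !addr0 !mul1mx mxadjM.
(* Antisymmetry turns the derivative of the right-hand factor [Z^*] into the second half of a
   commutator. *)
have -> : mxadj (rotgen R i j) = - rotgen R i j.
  rewrite /mxadj -/(conjv _) conjv_rotgen /rotgen linearB /= !trmx_delta.
  by rewrite opprB.
by rewrite mulmxN mulmxN !mulmxA.
Qed.

Lemma loop_taylor1 i j es (w x : 'cV[C]_n) : 
  taylor1 (fun t o => let W := mword (rotation i j t *m U o) es in
       (W *m x) i 0 * w j 0 * ((dot w (W *m x))^* ^+ 2 * dot w (W *m x)))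
    (fun o => let W := mword (U o) es in
       (W *m x) i 0 * w j 0 * ((dot w (W *m x))^* ^+ 2 * dot w (W *m x)))
    (fun o => let W := mword (U o) es in let D := dword (rotgen R i j) (U o) es in
      let psi := dot w (W *m x) in
      (D *m x) i 0 * w j 0 * (psi^* ^+ 2 * psi)
      + (W *m x) i 0 * w j 0 *
        (2%:R * psi^* * (dot w (D *m x))^* * psi + psi^* ^+ 2 * dot w (D *m x))).
Proof.
have hW := mword_taylor1 i j es.
have hWx := mtaylor1M hW (mtaylor1_mx T x).
have hpsi : taylor1 (fun t o => dot w (mword (rotation i j t *m U o) es *m x))
   (fun o => dot w (mword (U o) es *m x))
   (fun o => dot w (dword (rotgen R i j) (U o) es *m x)).
  have h := mtaylor1M (mtaylor1_mx T w^T) hWx.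
  apply: taylor1_eq (h 0 0) _ _ _ => [t o|o|o]; rewrite ?dotE//.
  by rewrite mul0mx mulmx0 add0r addr0.
have hj := taylor1J hpsi.
have hw : taylor1 (fun _ (_ : T) => w j 0) (fun _ => w j 0) (fun _ => 0).
  exact: (@taylor1_cst _ _ _ (cabs (w j 0))).
apply: taylor1_eq (taylor1M (taylor1M (hWx i 0) hw) (taylor1M (taylor1M hj hj) hpsi)) _ _ _.
- by move=> t o /=; rewrite expr2.
- by move=> o /=; rewrite expr2.
- move=> o /=; rewrite mulmx0 addr0; ring.
Qed.

End WordExpansion.

(** * Measurability, expectation and invariance in law *)

Section CMeasurable.
Context {d : measure_display} {T : measurableType d} {R : realType}.
Local Notation C := R[i].

Definition cmeas (f : T -> C) := measurable_fun setT (fun w => complex.Re (f w)) /\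
  measurable_fun setT (fun w => complex.Im (f w)).

Lemma cmeas_cst c : cmeas (fun _ => c).
Proof. by split; exact: measurable_cst. Qed.

Lemma cmeasD f g : cmeas f -> cmeas g -> cmeas (fun w => f w + g w).
Proof.
move=> [f1 f2] [g1 g2]; split.
  by under eq_fun do rewrite cReD; exact: measurable_funD.
by under eq_fun do rewrite cImD; exact: measurable_funD.
Qed.

Lemma cmeasM f g : cmeas f -> cmeas g -> cmeas (fun w => f w * g w).
Proof.
move=> [f1 f2] [g1 g2]; split.
  by under eq_fun do rewrite cReM; apply: measurable_funB; exact: measurable_funM.
by under eq_fun do rewrite cImM; apply: measurable_funD; exact: measurable_funM.
Qed.

Lemma cmeasJ f : cmeas f -> cmeas (fun w => (f w)^*).
Proof.
move=> [f1 f2]; split.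
  by under eq_fun do rewrite cReJ.
by under eq_fun do rewrite cImJ; exact: measurable_funN.
Qed.

Lemma cmeas_sum (I : Type) (r : seq I) f : (forall i : I, cmeas (f i)) ->
  cmeas (fun w => \sum_(i <- r) f i w).
Proof.
move=> h; elim: r => [|i r IH].
  by under eq_fun do rewrite big_nil; exact: cmeas_cst.
by under eq_fun do rewrite big_cons; exact: cmeasD.
Qed.

Lemma cmeas_abs2 f : cmeas f -> measurable_fun setT (fun w => cabs (f w) ^+ 2).
Proof.
move=> [f1 f2]; under eq_fun do rewrite sqr_cabs.
by apply: measurable_funD; exact: measurable_funX.
Qed.

Lemma cmeas_abs4 f : cmeas f -> measurable_fun setT (fun w => cabs (f w) ^+ 4).
Proof.
move=> h; under eq_fun do rewrite (exprM _ 2 2).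
by apply: measurable_funX; exact: cmeas_abs2.
Qed.

Definition mmeas m n (F : T -> 'M[C]_(m, n)) := forall i j, cmeas (fun w => F w i j).

Lemma mmeasM m n p (F : T -> 'M[C]_(m, n)) (G : T -> 'M[C]_(n, p)) :
  mmeas F -> mmeas G -> mmeas (fun w => F w *m G w).
Proof.
move=> hF hG i j; under eq_fun do rewrite mxE.
by apply: cmeas_sum => k; exact: cmeasM.
Qed.

Lemma mmeas_cst m n (M : 'M[C]_(m, n)) : mmeas (fun _ => M).
Proof. by move=> i j; exact: cmeas_cst. Qed.

Lemma mmeasD m n (F G : T -> 'M[C]_(m, n)) :
  mmeas F -> mmeas G -> mmeas (fun w => F w + G w).
Proof. by move=> hF hG i j; under eq_fun do rewrite mxE; exact: cmeasD. Qed.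

Lemma mmeas_adj m n (F : T -> 'M[C]_(m, n)) : mmeas F -> mmeas (fun w => mxadj (F w)).
Proof. by move=> hF i j; under eq_fun do rewrite !mxE; exact: cmeasJ. Qed.

Lemma mmeas_letter n (Z : T -> 'M[C]_n) e : mmeas Z -> mmeas (fun w => letter (Z w) e).
Proof.
move=> hZ; rewrite /letter; case: e.1; last exact: mmeas_cst.
by apply: mmeasM; [apply: mmeasM => //; exact: mmeas_cst|exact: mmeas_adj].
Qed.

Lemma mmeas_word n (Z : T -> 'M[C]_n) es : mmeas Z -> mmeas (fun w => mword (Z w) es).
Proof.
move=> hZ; elim: es => [|e es IH] /=; first exact: mmeas_cst.
by apply: mmeasM => //; exact: mmeas_letter.
Qed.

Lemma mmeas_dword n (Z : T -> 'M[C]_n) X es : mmeas Z ->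
  mmeas (fun w => dword X (Z w) es).
Proof.
move=> hZ; elim: es => [|e es IH] /=; first exact: mmeas_cst.
apply: mmeasD; last by apply: mmeasM => //; exact: mmeas_letter.
apply: mmeasM; last exact: mmeas_word.
case: e.1; last exact: mmeas_cst.
apply: mmeasD; first by apply: mmeasM; [exact: mmeas_cst|exact: mmeas_letter].
under eq_fun do rewrite -mulmxN.
by apply: mmeasM; [exact: mmeas_letter|exact: mmeas_cst].
Qed.

Lemma cmeas_dot n (w : 'cV[C]_n) (F : T -> 'M[C]_n) x : mmeas F ->
  cmeas (fun o => dot w (F o *m x)).
Proof.
move=> hF; under eq_fun do rewrite dotE.
by apply: mmeasM; [exact: mmeas_cst|apply: mmeasM => //; exact: mmeas_cst].
Qed.

Lemma cmeas_ntr n (F : T -> 'M[C]_n) : mmeas F -> cmeas (fun o => ntr (F o)).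
Proof.
move=> hF; apply: cmeasM; last exact: cmeas_cst.
by apply: cmeas_sum => i; exact: hF.
Qed.

End CMeasurable.

(** * Expectations of bounded measurable functions *)

Section Expectation.
Context {d : measure_display} {T : measurableType d} {R : realType} (P : probability T R).

Definition bmeas (f : T -> R) := measurable_fun setT f /\ exists K, forall w, `|f w| <= K.
Definition Ex (f : T -> R) : R := \int[P]_w f w.

Lemma bmeas_integrable f : bmeas f -> P.-integrable setT (EFin \o f).
Proof.
move=> [mf [K hK]]; apply: measurable_bounded_integrable => //.
  by rewrite (le_lt_trans (probability_le1 _ _))// ltry.
exists K; split => [|x xK y _ /=]; first exact: num_real.
exact: le_trans (hK y) (ltW xK).
Qed.

Lemma bmeas_cst c : bmeas (fun _ => c).
Proof. by split; [exact: measurable_cst|exists `|c|]. Qed.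

Lemma bmeasD f g : bmeas f -> bmeas g -> bmeas (fun w => f w + g w).
Proof.
move=> [mf [K hK]] [mg [L hL]]; split; first exact: measurable_funD.
by exists (K + L) => w; rewrite (le_trans (ler_normD _ _))// lerD.
Qed.

Lemma bmeasZ c f : bmeas f -> bmeas (fun w => c * f w).
Proof.
move=> [mf [K hK]]; split; first by apply: measurable_funM => //; exact: measurable_cst.
by exists (`|c| * K) => w; rewrite normrM ler_wpM2l.
Qed.

Lemma bmeas_sum (I : Type) (r : seq I) f : (forall i : I, bmeas (f i)) ->
  bmeas (fun w => \sum_(i <- r) f i w).
Proof.
move=> h; elim: r => [|i r IH].
  by under eq_fun do rewrite big_nil; exact: bmeas_cst.
by under eq_fun do rewrite big_cons; exact: bmeasD.
Qed.

Lemma ExD f g : bmeas f -> bmeas g -> Ex (fun w => f w + g w) = Ex f + Ex g.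
Proof. by move=> hf hg; apply: RintegralD => //; exact: bmeas_integrable. Qed.

Lemma ExZ c f : bmeas f -> Ex (fun w => c * f w) = c * Ex f.
Proof. by move=> hf; apply: RintegralZl => //; exact: bmeas_integrable. Qed.

Lemma Ex_cst c : Ex (fun _ => c) = c.
Proof. rewrite /Ex Rintegral_cst// -[RHS]mulr1; congr (_ * _).
exact: (congr1 fine (@probability_setT _ _ _ P)). Qed.

Lemma Ex_sum (I : Type) (r : seq I) f : (forall i : I, bmeas (f i)) ->
  Ex (fun w => \sum_(i <- r) f i w) = \sum_(i <- r) Ex (f i).
Proof.
move=> h; elim: r => [|i r IH].
  by rewrite big_nil; under eq_fun do rewrite big_nil; rewrite Ex_cst.
rewrite big_cons; under eq_fun do rewrite big_cons.
by rewrite ExD ?IH//; exact: bmeas_sum.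
Qed.

Lemma Ex_le f g : bmeas f -> bmeas g -> (forall w, f w <= g w) -> Ex f <= Ex g.
Proof. by move=> hf hg fg; apply: le_Rintegral => //; exact: bmeas_integrable. Qed.

(** As the mean is constant along the curve, the expansion gives [t |E f1| <= K t^2] on [[0, 1]];
    divide by [t] and let it tend to 0. *)
Lemma Ex_taylor f f0 f1 (K : R) : (forall t, bmeas (f t)) -> bmeas f0 -> bmeas f1 ->
  (forall t w, 0 <= t <= 1 -> `|f t w - f0 w - t * f1 w| <= K * t ^+ 2) ->
  (forall t, Ex (f t) = Ex f0) -> Ex f1 = 0.
Proof.
move=> hf hf0 hf1 hK he.
have h t : 0 <= t <= 1 -> t * `|Ex f1| <= K * t ^+ 2.
  move=> ht; have /andP[t0 t1] := ht.
  have e : t * Ex f1 = Ex (fun w => f0 w + t * f1 w) - Ex (f t).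
    by rewrite he ExD ?ExZ//; [ring|exact: bmeasZ].
  have up : Ex (f t) <= Ex (fun w => f0 w + t * f1 w) + K * t ^+ 2.
    rewrite -[K * _]Ex_cst -ExD; [| by apply: bmeasD => //; exact: bmeasZ|exact: bmeas_cst].
    apply: Ex_le => //.
      by apply: bmeasD; [apply: bmeasD => //; exact: bmeasZ|exact: bmeas_cst].
    by move=> w; have := hK t w ht; rewrite ler_norml => /andP[_]; lra.
  have lo : Ex (fun w => f0 w + t * f1 w) <= Ex (f t) + K * t ^+ 2.
    rewrite -[K * _]Ex_cst -ExD; [|by []|exact: bmeas_cst].
    apply: Ex_le => //; first by apply: bmeasD => //; exact: bmeasZ.
      by apply: bmeasD => //; exact: bmeas_cst.
    by move=> w; have := hK t w ht; rewrite ler_norml => /andP[+ _]; lra.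
  rewrite -[t in t * _]ger0_norm// -normrM e ler_norml; lra.
apply/eqP; rewrite -normr_eq0 eq_le normr_ge0 andbT.
apply/ler_addgt0Pr => e e0; rewrite add0r.
have K1 : 0 < `|K| + 1 by rewrite ltr_wpDl.
pose t := Num.min 1 (e / (`|K| + 1)).
have t0 : 0 < t by rewrite lt_min ltr01 divr_gt0.
have t1 : t <= 1 by rewrite ge_min lexx.
have := h t; rewrite (ltW t0) t1 => /(_ isT).
rewrite expr2 mulrCA ler_pM2l// => /le_trans; apply.
apply: le_trans (_ : (`|K| + 1) * t <= _).
  by apply: ler_wpM2r; [exact: ltW|rewrite (le_trans (ler_norm _))// lerDl].
by rewrite mulrC -ler_pdivlMr// ge_min lexx orbT.
Qed.

End Expectation.

(** * Equality in law of random matrices *)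

Section MatrixSpace.
Variables (R : realType) (n : nat).
Local Notation C := R[i].

Definition mxspace := 'M[C]_n.
HB.instance Definition _ := Choice.on mxspace.
HB.instance Definition _ := isPointed.Build mxspace (0 : 'M[C]_n).

(** The rectangles on which [haar] tests invariance. They are stable under intersection, so they
    determine a law on the sigma-algebra they generate. *)
Definition box (Bre Bim : 'I_n -> 'I_n -> set R) : set mxspace :=
  [set M | forall i j, Bre i j (complex.Re (M i j)) /\ Bim i j (complex.Im (M i j))].
Definition boxes : set (set mxspace) :=
  [set S | exists Bre Bim, [/\ forall i j, measurable (Bre i j : set R),
     forall i j, measurable (Bim i j : set R) & S = box Bre Bim]].

Lemma boxesI : setI_closed boxes.
Proof.
move=> _ _ [B1 [B2 [m1 m2 ->]]] [D1 [D2 [m3 m4 ->]]].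
exists (fun i j => B1 i j `&` D1 i j), (fun i j => B2 i j `&` D2 i j); split.
- by move=> i j; exact: measurableI.
- by move=> i j; exact: measurableI.
- apply/seteqP; split => [M [h1 h2] i j|M h].
    by have [a b] := h1 i j; have [c e] := h2 i j.
  by split=> i j; have [[a b] [c e]] := h i j.
Qed.

Lemma boxesT : boxes setT.
Proof.
by exists (fun _ _ => setT), (fun _ _ => setT); split => //; apply/seteqP; split.
Qed.

Local Notation mxm := (g_sigma_algebraType boxes).

Lemma coord_meas : mmeas (fun M : mxm => (M : 'M[C]_n)).
Proof.
move=> i j; split=> _ B mB; rewrite setTI; apply: sub_sigma_algebra.
  exists (fun i' j' => if (i' == i) && (j' == j) then B else setT), (fun _ _ => setT).
  split => // [i' j'|]; first by case: ifP.
  apply/seteqP; split => [M /= hM i' j'|M /(_ i j)[]]; last by rewrite !eqxx.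
  by split => //; case: ifP => // /andP[/eqP-> /eqP->].
exists (fun _ _ => setT), (fun i' j' => if (i' == i) && (j' == j) then B else setT).
split => // [i' j'|]; first by case: ifP.
apply/seteqP; split => [M /= hM i' j'|M /(_ i j)[]]; last by rewrite !eqxx.
by split => //; case: ifP => // /andP[/eqP-> /eqP->].
Qed.

Context {d : measure_display} {T : measurableType d} (P : probability T R).

Lemma preimage_box (Z : T -> 'M[C]_n) Bre Bim : mmeas Z ->
  (forall i j, measurable (Bre i j : set R)) -> (forall i j, measurable (Bim i j : set R)) ->
  measurable (Z @^-1` box Bre Bim).
Proof.
move=> hZ m1 m2.
have -> : Z @^-1` box Bre Bim = \bigcap_(p in [set: 'I_n * 'I_n])
   ([set w | Bre p.1 p.2 (complex.Re (Z w p.1 p.2))] `&`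
    [set w | Bim p.1 p.2 (complex.Im (Z w p.1 p.2))]).
  by apply/seteqP; split => [w h [i j] _|w h i j]; [exact: h|exact: (h (i, j) I)].
apply: fin_bigcap_measurable; first exact: finite_finset.
move=> [i j] _; apply: measurableI.
  by have := (hZ i j).1 measurableT _ (m1 i j); rewrite setTI.
by have := (hZ i j).2 measurableT _ (m2 i j); rewrite setTI.
Qed.

Lemma mxm_meas (Z : T -> 'M[C]_n) : mmeas Z -> measurable_fun setT (Z : T -> mxm).
Proof.
move=> hZ; apply: (@measurability _ _ _ _ setT (Z : T -> mxm) boxes) => //.
move=> _ [_ [Bre [Bim [m1 m2 ->]]] <-]; rewrite setTI.
exact: preimage_box.
Qed.

(** The image measures agree on an intersection-stable generating class that contains the whole
    space, hence everywhere; both means are integrals of [h] against them. *)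
Lemma Ex_eq_law (Z Z' : T -> 'M[C]_n) (h : mxm -> R) : mmeas Z -> mmeas Z' ->
  (forall Bre Bim, (forall i j, measurable (Bre i j : set R)) ->
     (forall i j, measurable (Bim i j : set R)) ->
     P (Z @^-1` box Bre Bim) = P (Z' @^-1` box Bre Bim)) ->
  measurable_fun setT h ->
  bmeas (fun w => h (Z w)) -> bmeas (fun w => h (Z' w)) ->
  Ex P (fun w => h (Z w)) = Ex P (fun w => h (Z' w)).
Proof.
move=> hZ hZ' hlaw mh b b'.
have mZ := mxm_meas hZ; have mZ' := mxm_meas hZ'.
have mh' : measurable_fun setT (EFin \o h) by exact/measurable_EFinP.
rewrite /Ex /Rintegral; congr fine.
have i1 := integral_pushforward mZ mh' (bmeas_integrable P b) measurableT.
have i2 := integral_pushforward mZ' mh' (bmeas_integrable P b') measurableT.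
rewrite !preimage_setT in i1 i2.
rewrite -[LHS]i1 -[RHS]i2.
apply: eq_measure_integral => A mA _.
apply: (@measure_unique _ _ mxm boxes (fun _ => setT)) => //.
- exact: boxesI.
- by move=> _; exact: boxesT.
- by rewrite bigcup_const//; exists 0%N.
- by move=> _ [Bre [Bim [m1 m2 ->]]]; exact: hlaw.
- move=> _; rewrite /= /pushforward preimage_setT.
  by apply: le_lt_trans (probability_le1 _ measurableT) _; exact: ltry.
Qed.

End MatrixSpace.

(** * Fourth moments of alternating words *)

Section FourthPowers.
Variable R : realType.
Local Notation C := R[i].

(** Cauchy-Schwarz against the constant 1, used for [a] and again for [a^2]. *)
Lemma sum_pow4_le (n : nat) (a : 'I_n -> R) :
  (\sum_i a i) ^+ 4 <= n%:R ^+ 3 * \sum_i a i ^+ 4.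
Proof.
have CS (b : 'I_n -> R) : (\sum_i b i) ^+ 2 <= n%:R * \sum_i b i ^+ 2.
  have := sum_Cauchy_Schwarz (fun _ => 1) b.
  rewrite expr1n sumr_const card_ord.
  by under eq_bigr do rewrite mul1r.
have pow4 (u : R) : u ^+ 4 = (u ^+ 2) ^+ 2 by rewrite -exprM.
have h1 := CS a; have h2 := CS (fun i => a i ^+ 2).
rewrite pow4; apply: le_trans (_ : (n%:R * \sum_i a i ^+ 2) ^+ 2 <= _).
  by rewrite lerXn2r ?nnegrE ?sqr_ge0// mulr_ge0// sumr_ge0// => i _; rewrite sqr_ge0.
rewrite exprMn (exprSr _ 2) -mulrA ler_wpM2l ?sqr_ge0//.
by under [X in _ <= _ * X]eq_bigr do rewrite pow4.
Qed.

Lemma add_pow4_le (a b : R) : (a + b) ^+ 4 <= 8 * (a ^+ 4 + b ^+ 4).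
Proof.
have := @sum_pow4_le 2 (fun i => if i == 0 then a else b).
rewrite !big_ord_recl !big_ord0 /= !addr0.
by rewrite -natrX.
Qed.

Lemma cabs_add_pow4_le (a b : C) :
  cabs (a + b) ^+ 4 <= 8 * (cabs a ^+ 4 + cabs b ^+ 4).
Proof.
apply: le_trans (add_pow4_le _ _).
by rewrite lerXn2r ?nnegrE ?cabs_ge0 ?addr_ge0 ?cabs_ge0// cabsD.
Qed.

Lemma cabs_entry n (x : 'cV[C]_n) i : sqn x <= 1 -> cabs (x i 0) <= 1.
Proof.
move=> h; have -> : x i 0 = dot (stdvec R i) x.
  rewrite /dot (bigD1 i)//= mxE !eqxx mul1r big1 ?addr0// => j /negPf jn.
  by rewrite mxE jn mul0r.
by apply: cabs_dot_le1; rewrite ?sqn_stdvec.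
Qed.

(* Young's inequality absorbs the cubic and quadratic terms. *)
Lemma loop_young (N q S Re c : R) : 0 < N -> 0 <= q -> 0 <= S ->
  N * q ^+ 4 <= Re + N * S * q ^+ 3 + c * q ^+ 2 ->
  q ^+ 4 <= 2 / N * Re + 128 * S ^+ 4 + 2 * c ^+ 2 / N ^+ 2.
Proof.
move=> N0 q0 S0 h.
have h1 : S * q ^+ 3 <= 64 * S ^+ 4 + q ^+ 4 / 4.
  (* If [q <= 4 S], then [q^3] is replaced by [(4 S)^3], whence the 64; otherwise [S < q / 4] and
     the cubic term is absorbed by [q^4 / 4]. *)
  have [sq|sq] := leP (q / 4) S.
    apply: le_trans (_ : 64 * S ^+ 4 <= _); last by rewrite lerDl divr_ge0// exprn_ge0.
    have -> : 64 * S ^+ 4 = S * (4 * S) ^+ 3 by ring.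
    rewrite ler_wpM2l// lerXn2r ?nnegrE//; [by rewrite mulr_ge0|lra].
  apply: le_trans (_ : q ^+ 4 / 4 <= _); last by rewrite lerDr mulr_ge0// exprn_ge0.
  have -> : q ^+ 4 / 4 = q / 4 * q ^+ 3 by ring.
  by rewrite ler_wpM2r ?exprn_ge0// ltW.
have h2 : c / N * q ^+ 2 <= (c / N) ^+ 2 + q ^+ 4 / 4.
  set a := c / N; have := sqr_ge0 (a - q ^+ 2 / 2).
  have -> : (a - q ^+ 2 / 2) ^+ 2 = a ^+ 2 - a * q ^+ 2 + q ^+ 4 / 4 by field.
  lra.
have h3 : q ^+ 4 <= Re / N + S * q ^+ 3 + c / N * q ^+ 2.
  rewrite -(ler_pM2l N0); apply: le_trans h _.
  rewrite le_eqVlt; apply/orP; left; apply/eqP.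
  by field; rewrite gt_eqF.
have -> : 2 * c ^+ 2 / N ^+ 2 = 2 * (c / N) ^+ 2 by field; rewrite gt_eqF.
have -> : 2 / N * Re = 2 * (Re / N) by field; rewrite gt_eqF.
lra.
Qed.

End FourthPowers.

(** * The loop inequality in mean and the induction on the length *)

Section RandomWords.
Context {d : measure_display} {T : measurableType d} {R : realType} (P : probability T R).
Local Notation C := R[i].

(** What the unitary and the orthogonal case share: invariance under left multiplication by real
    orthogonal matrices. Unitarity is asked at every sample point so that the bounds for
    contractions hold pointwise. *)
Definition rot_inv n (U : T -> 'M[C]_n) :=
  [/\ forall w, unitary (U w), mmeas U
    & forall V, unitary V -> real_mx V -> forall Bre Bim,
      (forall i j, measurable (Bre i j : set R)) -> (forall i j, measurable (Bim i j : set R)) ->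
      P (U @^-1` box Bre Bim) = P ((fun w => V *m U w) @^-1` box Bre Bim)].

Section Step.
Variables (n' : nat) (U : T -> 'M[C]_n'.+1).
Local Notation n := n'.+1.
Hypothesis hU : rot_inv U.
Local Notation elt := (bool * 'M[C]_n)%type.

Let unit_mul V o : unitary V -> unitary (V *m U o).
Proof.
move=> hV; rewrite /unitary mxadjM mulmxA -(mulmxA (mxadj (U o))) hV mulmx1.
by have [h _ _] := hU; exact: h.
Qed.

Section Fixed.
Variables (es : seq elt) (w x : 'cV[C]_n).
Hypotheses (hes : contrs es) (hw : sqn w <= 1) (hx : sqn x <= 1).

Let psi (Z : 'M[C]_n) := dot w (mword Z es *m x).
Let F i j (Z : 'M[C]_n) : C :=
  (mword Z es *m x) i 0 * w j 0 * ((psi Z)^* ^+ 2 * psi Z).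

Let psi_le1 Z : unitary Z -> cabs (psi Z) <= 1.
Proof. by move=> hZ; apply: cabs_dot_le1 => //; apply: contr_sqn => //; exact: contr_mword. Qed.

Let F_le1 i j Z : unitary Z -> cabs (F i j Z) <= 1.
Proof.
move=> hZ; rewrite !cabsM !cabsJ.
have h1 : cabs ((mword Z es *m x) i 0) <= 1.
  by apply: cabs_entry; apply: contr_sqn => //; exact: contr_mword.
have h2 : cabs (w j 0) <= 1 by exact: cabs_entry.
by rewrite !mulr_ile1 ?mulr_ge0 ?cabs_ge0// psi_le1.
Qed.

Let F_meas i j d' (T' : measurableType d') (Z : T' -> 'M[C]_n) :
  mmeas Z -> cmeas (fun o => F i j (Z o)).
Proof.
move=> hZ; have hW := @mmeas_word _ _ _ _ Z es hZ.
have hp : cmeas (fun o => psi (Z o)) by exact: cmeas_dot.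
apply: cmeasM.
  by apply: cmeasM; [exact: (mmeasM hW (mmeas_cst x))|exact: cmeas_cst].
apply: cmeasM => //; under eq_fun do rewrite expr2.
by apply: cmeasM; exact: cmeasJ.
Qed.

Let F_bmeas i j (Z : T -> 'M[C]_n) : (forall o, unitary (Z o)) -> mmeas Z ->
  bmeas (fun o => complex.Re (F i j (Z o))).
Proof.
move=> hZ mZ; split; first by have [] := F_meas i j mZ.
exists 1 => o; rewrite ler_norml; apply/andP; split.
  rewrite lerNl -cReN; apply: le_trans (Re_le_cabs _) _; rewrite cabsN.
  exact: F_le1.
by apply: le_trans (Re_le_cabs _) _; exact: F_le1.
Qed.

Let norm_Re_le (z : C) : `|complex.Re z| <= cabs z.
Proof.
rewrite ler_norml Re_le_cabs andbT lerNl -cReN.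
by apply: le_trans (Re_le_cabs _) _; rewrite cabsN.
Qed.

Lemma loop_deriv_bmeas i j :
  bmeas (fun o => complex.Re (loop_deriv (U o) es w x i j)).
Proof.
have [h1 h2 _] := hU.
have hW := @mmeas_word _ _ _ _ U es h2.
have hD := @mmeas_dword _ _ _ _ U (rotgen R i j) es h2.
have hp : cmeas (fun o => dot w (mword (U o) es *m x)) by exact: cmeas_dot.
have hq : cmeas (fun o => dot w (dword (rotgen R i j) (U o) es *m x)) by exact: cmeas_dot.
have hp2 : cmeas (fun o => (dot w (mword (U o) es *m x))^* ^+ 2).
  by under eq_fun do rewrite expr2; apply: cmeasM; exact: cmeasJ.
split.
  suff : cmeas (fun o => loop_deriv (U o) es w x i j) by case.
  apply: cmeasD; apply: cmeasM.
  - by apply: cmeasM; [exact: (mmeasM hD (mmeas_cst x))|exact: cmeas_cst].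
  - exact: cmeasM.
  - by apply: cmeasM; [exact: (mmeasM hW (mmeas_cst x))|exact: cmeas_cst].
  - apply: cmeasD; last exact: cmeasM.
    apply: cmeasM => //; apply: cmeasM; last exact: cmeasJ.
    by apply: cmeasM; [exact: cmeas_cst|exact: cmeasJ].
have [K hK] := loop_taylor1 h1 i j es w x.
exists K => o; apply: le_trans (norm_Re_le _) _.
by have [] := hK 0 o; rewrite ?lexx ?ler01.
Qed.

(** The curve [rotation i j t *m U] has the law of [U] for all [t], so the mean of
    [(W x)_i w_j conj(psi)^2 psi] along it is constant and its derivative has mean 0. *)
Lemma loop_deriv_mean i j :
  Ex P (fun o => complex.Re (loop_deriv (U o) es w x i j)) = 0.
Proof.
have [h1 h2 h3] := hU.
have [K hK] := loop_taylor1 h1 i j es w x.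
have mV t : mmeas (fun o => rotation i j t *m U o).
  by apply: mmeasM => //; exact: mmeas_cst.
have uV t o : unitary (rotation i j t *m U o) by apply: unit_mul; exact: rotation_unitary.
apply: (@Ex_taylor _ _ _ P (fun t o => complex.Re (F i j (rotation i j t *m U o)))
   (fun o => complex.Re (F i j (U o))) _ K).
- by move=> t; apply: F_bmeas => //; exact: uV.
- exact: F_bmeas.
- exact: loop_deriv_bmeas.
- move=> t o ht; have [/= h _ _] := hK t o ht.
  apply: le_trans h; apply: le_trans (norm_Re_le _).
  have e (a b c : C) : complex.Re (a - b - t%:C * c) =
      complex.Re a - complex.Re b - t * complex.Re c.
    by rewrite !cReD !cReN cReM /= mul0r subr0.
  by rewrite e.
- move=> t.
  have mF : measurable_fun setT (fun Z : g_sigma_algebraType (@boxes R n) => complex.Re (F i j Z)).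
    by have [] := F_meas i j (@coord_meas R n).
  apply/esym.
  apply: (@Ex_eq_law R n _ _ P U (fun o => rotation i j t *m U o) (fun Z => complex.Re (F i j Z))) => //.
  + by apply: h3; [exact: rotation_unitary|exact: rotation_real].
  + exact: F_bmeas.
  + by apply: F_bmeas => //; exact: uV.
Qed.

Lemma abs4_bmeas (f : T -> C) : cmeas f -> (forall o, cabs (f o) <= 1) ->
  bmeas (fun o => cabs (f o) ^+ 4).
Proof.
move=> mf hf; split; first exact: cmeas_abs4.
by exists 1 => o; rewrite ger0_norm ?exprn_ge0 ?cabs_ge0// exprn_ile1// cabs_ge0.
Qed.

Definition word4 : T -> R := fun o => cabs (psi (U o)) ^+ 4.
Definition trace4 (fs : seq elt) : T -> R := fun o => cabs (ntr (mword (U o) fs)) ^+ 4.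

Lemma word4_bmeas : bmeas word4.
Proof.
have [h1 h2 _] := hU; apply: abs4_bmeas; last by move=> o; exact: psi_le1.
exact/cmeas_dot/mmeas_word.
Qed.

Lemma trace4_bmeas fs : contrs fs -> bmeas (trace4 fs).
Proof.
move=> hfs; have [h1 h2 _] := hU; apply: abs4_bmeas; first exact/cmeas_ntr/mmeas_word.
by move=> o; apply: ntr_contr; exact: contr_mword.
Qed.

Let contrs_take l : contrs (take l es).
Proof. by apply: contrs_sub hes => e; exact: mem_take. Qed.

(** The traces that enter are those of prefixes ending just before or just after a B-letter. The
    whole word is among them exactly when its last letter is a B-letter; being no shorter, it has a
    hypothesis of its own. *)
Lemma word4_loop (K c : R) : 2048 <= K -> (0 < size es)%N -> (nth (false, 0) es 0).1 -> 0 <= c ->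
  (forall l, (0 < l < size es)%N -> Ex P (trace4 (take l es)) <= c) ->
  ((nth (false, 0) es (size es).-1).1 -> Ex P (trace4 es) <= c) ->
  Ex P word4 <= K * (size es)%:R ^+ 4 * c + K * (size es)%:R ^+ 2 / n%:R ^+ 2.
Proof.
move=> hK r0 b0 c0 hc hlast; set r := size es in r0 hc hlast *.
pose t l := if (nth (false, 0) es l).1 then
   8 * ((if l is 0 then 0 else Ex P (trace4 (take l es))) + Ex P (trace4 (take l.+1 es)))
   else 0.
pose tt l o := if (nth (false, 0) es l).1 then
   8 * ((if l is 0 then 0 else trace4 (take l es) o) + trace4 (take l.+1 es) o)
   else 0.
have btt l : bmeas (tt l).
  rewrite /tt; case: (nth _ _ _).1; last exact: bmeas_cst.
  apply: bmeasZ; apply: bmeasD; last exact: trace4_bmeas.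
  by case: l => [|l]; [exact: bmeas_cst|exact: trace4_bmeas].
have Ett l : Ex P (tt l) = t l.
  rewrite /tt /t; case: (nth _ _ _).1; last exact: Ex_cst.
  have bz : bmeas (fun o => if l is 0 then 0 else trace4 (take l es) o).
    by case: l => [|l]; [exact: bmeas_cst|exact: trace4_bmeas].
  have bz' := trace4_bmeas (contrs_take (l := l.+1)).
  rewrite ExZ; last exact: bmeasD.
  by rewrite ExD//; case: l {bz bz'} => // ; rewrite Ex_cst.
have hpt o : word4 o <= 2 / n%:R * (\sum_i \sum_j complex.Re (loop_deriv (U o) es w x i j))
   + (128 * (r%:R ^+ 3)) * (\sum_(l < r) tt l o) + 392 * r%:R ^+ 2 / n%:R ^+ 2.
  have [h1 _ _] := hU.
  have h := loop_pointwise (h1 o) hes hw hx r0 b0.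
  have S0 l : 0 <= loop_term (U o) es l.
    rewrite /loop_term; case: ifP => // _; apply: addr_ge0; last exact: cabs_ge0.
    by case: l => // l; exact: cabs_ge0.
  have := loop_young _ _ _ h => /(_ _ _ _)/le_trans; apply => //.
  - exact: cabs_ge0.
  - by apply: sumr_ge0 => l _; exact: S0.
  rewrite cRe_sum; under eq_bigr do rewrite cRe_sum.
  (* [392 = 2 * 14^2], from [loop_young] with [c = 14 r]. *)
  apply: lerD; last by rewrite (_ : 2 * (14 * r%:R) ^+ 2 = 392 * r%:R ^+ 2) //; ring.
  apply: lerD => //; rewrite -mulrA ler_wpM2l//.
  apply: le_trans (sum_pow4_le _) _; rewrite ler_wpM2l ?exprn_ge0//.
  apply: ler_sum => l _; rewrite /loop_term /tt; case: ifP => _; last by rewrite expr0n.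
  apply: le_trans (add_pow4_le _ _) _; rewrite ler_wpM2l// lerD2r.
  by case: (l : nat) => // ; rewrite expr0n.
have bd := loop_deriv_bmeas.
have bS : bmeas (fun o => \sum_i \sum_j complex.Re (loop_deriv (U o) es w x i j)).
  by apply: bmeas_sum => i; apply: bmeas_sum => j; exact: bd.
have bt : bmeas (fun o => \sum_(l < r) tt l o) by apply: bmeas_sum => l; exact: btt.
have b1 := bmeasD (bmeasZ (2 / n%:R) bS) (bmeasZ (128 * r%:R ^+ 3) bt).
apply: le_trans (Ex_le P word4_bmeas (bmeasD b1 (bmeas_cst _)) hpt) _.
rewrite ExD ?Ex_cst//; last exact: bmeas_cst.
rewrite ExD; [|exact: bmeasZ|exact: bmeasZ].
rewrite !ExZ// !Ex_sum//; last by move=> i; apply: bmeas_sum => j; exact: bd.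
rewrite [X in 2 / _ * X]big1 ?mulr0 ?add0r; last first.
  by move=> i _; rewrite Ex_sum// big1// => j _; exact: loop_deriv_mean.
apply: lerD; last first.
  by rewrite ler_pM2r ?invr_gt0 ?exprn_gt0 ?ltr0n// ler_wpM2r ?exprn_ge0//; lra.
(* [2048 = 128 * 16]: 128 comes from Young's inequality and 16 from the fourth power of a sum of two
   traces. The power [r^4] is [r^3] from the fourth power of the sum over letters, times the number
   of letters. *)
apply: (@le_trans _ _ (2048 * r%:R ^+ 4 * c)); last first.
  by rewrite ler_wpM2r// ler_wpM2r// exprn_ge0.
apply: le_trans (_ : 128 * r%:R ^+ 3 * \sum_(l < r) (16 * c) <= _).
  rewrite ler_wpM2l ?mulr_ge0 ?exprn_ge0//; apply: ler_sum => -[l lr] _ /=.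
  rewrite Ett /t; case: ifP => hb; last by rewrite mulr_ge0.
  have e1 : (if l is 0 then 0 else Ex P (trace4 (take l es))) <= c.
    by case: l lr {hb} => // l lr; exact: hc.
  have e2 : Ex P (trace4 (take l.+1 es)) <= c.
    have := lr; rewrite leq_eqVlt => /orP[/eqP el|lr']; last exact: hc.
    by rewrite el take_size; apply: hlast; rewrite -el.
  rewrite (_ : 16 * c = 8 * (c + c)); last by ring.
  by rewrite ler_wpM2l// lerD.
rewrite sumr_const card_ord -mulr_natr le_eqVlt; apply/orP; left; apply/eqP.
by ring.
Qed.

End Fixed.

(** The normalised trace is the mean of the diagonal entries [e_l^T W e_l], and the fourth power of
    a mean is at most the mean of the fourth powers. *)
Lemma trace4_le (fs : seq elt) (c : R) : contrs fs ->
  (forall w x, sqn w <= 1 -> sqn x <= 1 -> Ex P (word4 fs w x) <= c) ->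
  Ex P (trace4 fs) <= c.
Proof.
move=> hfs hc.
pose g l := word4 fs (stdvec R l) (stdvec R l).
have bg l : bmeas (g l : T -> R) by apply: word4_bmeas; rewrite ?sqn_stdvec.
have hpt o : trace4 fs o <= n%:R^-1 * \sum_(l < n) g l o.
  rewrite /trace4 /ntr trace_dot cabsM cabsV cabs_nat exprMn.
  apply: le_trans (_ : (\sum_(l < n) cabs (dot (stdvec R l) (mword (U o) fs *m stdvec R l))) ^+ 4
     * n%:R^-1 ^+ 4 <= _).
    rewrite ler_wpM2r ?exprn_ge0 ?invr_ge0// lerXn2r ?nnegrE ?cabs_ge0 ?cabs_sum//.
    by apply: sumr_ge0 => l _; exact: cabs_ge0.
  apply: le_trans (ler_wpM2r _ (sum_pow4_le _)) _; first by rewrite exprn_ge0 ?invr_ge0.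
  rewrite le_eqVlt; apply/orP; left; apply/eqP; rewrite /g /word4.
  set s := \sum_i _; set N : R := n%:R.
  have N0 : N != 0 by rewrite pnatr_eq0.
  by field.
apply: le_trans (Ex_le P (trace4_bmeas hfs) (bmeasZ _ (bmeas_sum _ bg)) hpt) _.
rewrite ExZ ?Ex_sum//; last exact: bmeas_sum.
rewrite mulrC ler_pdivrMr ?ltr0n//.
apply: le_trans (_ : \sum_(l < n) c <= _).
  by apply: ler_sum => l _; apply: hc; rewrite sqn_stdvec.
by rewrite sumr_const card_ord mulr_natr.
Qed.

Definition centered (es : seq elt) := forall e, e \in es -> ntr e.2 = 0.

Lemma mul_adj_letter o (b : 'M[C]_n) : mxadj (U o) *m (U o *m b) = b.
Proof. by have [h _ _] := hU; rewrite mulmxA h mul1mx. Qed.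

Lemma ntr_letter o e : ntr (letter (U o) e) = ntr e.2.
Proof.
rewrite /letter; case: e.1 => //.
by rewrite /ntr mxtrace_mulC mul_adj_letter.
Qed.

Lemma ntrD (M N : 'M[C]_n) : ntr (M + N) = ntr M + ntr N.
Proof. by rewrite /ntr mxtraceD mulrDl. Qed.

Lemma ntrZ a (M : 'M[C]_n) : ntr (a *: M) = a * ntr M.
Proof. by rewrite /ntr mxtraceZ mulrA. Qed.

Lemma ntr_scalar a : ntr (a%:M : 'M[C]_n) = a.
Proof. by rewrite /ntr mxtrace_scalar -[a *+ _]mulr_natr mulfK// pnatr_eq0. Qed.

(** Centring a product of contractions may double its norm; the factor 1/2 makes it a contraction
    again. *)
Definition merged (a b : 'M[C]_n) : 'M[C]_n := 2^-1 *: (b *m a - (ntr (b *m a))%:M).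

Lemma merged_contr a b : contr a -> contr b -> contr (merged a b).
Proof.
move=> ha hb x; have hc : cabs (ntr (b *m a)) <= 1 by apply: ntr_contr; exact: contrM.
rewrite /merged -scalemxAl sqnZ cabsV (cabs_nat _ 2) mulmxBl mul_scalar_mx.
set y := b *m a *m x; set z := _ *: x.
have hy : sqn y <= sqn x by exact: (contrM hb ha).
have hz : sqn z <= sqn x.
  by rewrite sqnZ ler_piMl ?sqn_ge0// exprn_ile1 ?cabs_ge0.
have : sqn (y - z) <= 2 * sqn y + 2 * sqn z.
  rewrite /sqn !mulr_sumr -big_split /=; apply: ler_sum => i _; rewrite mxE [X in _ + X]mxE.
  have := cabsB (y i 0) (z i 0); set u := cabs (y i 0); set v := cabs (z i 0) => h.
  have h2 : cabs (y i 0 - z i 0) ^+ 2 <= (u + v) ^+ 2.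
    by rewrite lerXn2r ?nnegrE ?addr_ge0 ?cabs_ge0.
  by have := sqr_ge0 (u - v); move: h2; rewrite !expr2; lra.
rewrite exprVn -natrX; lra.
Qed.

Lemma merged_ntr a b : ntr (merged a b) = 0.
Proof.
by rewrite /merged ntrZ -scaleN1r ntrD ntrZ mulN1r ntr_scalar subrr mulr0.
Qed.

(** Cyclicity of the trace brings the last B-letter in front of the first, [U^* U = 1] fuses the
    two, and the fused letter is split into its centred part and its trace. *)
Lemma ntr_merge o a b mid :
  ntr (mword (U o) ((true, a) :: rcons mid (true, b))) =
  2 * ntr (mword (U o) ((true, merged a b) :: mid))
  + ntr (b *m a) * ntr (mword (U o) mid).
Proof.
have [h _ _] := hU.
rewrite -cats1 -cat_cons mword_cat /= mulmx1.
rewrite -!ntrZ -ntrD /ntr; congr (_ / _).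
rewrite mxtrace_mulC mulmxA /letter /=; congr mxtrace.
rewrite -!mulmxA mul_adj_letter !mulmxA.
rewrite /merged -scalemxAr -!scalemxAl scalerA mulfV ?pnatr_eq0// scale1r.
rewrite mulmxBr !mulmxBl mul_mx_scalar -!scalemxAl.
by rewrite (unitary_mulVr (h o)) mul1mx -!mulmxA subrK.
Qed.

End Step.

Definition alternates n (es : seq (bool * 'M[C]_n)) := sorted (fun x y => x.1 != y.1) es.

Lemma alternating_no_true n (es : seq (bool * 'M[C]_n)) :
  alternates es -> ~~ has fst es -> (size es <= 1)%N.
Proof. by case: es => [|[[] a] [|[[] b] es]]. Qed.

(** The constant is uniform in the dimension, the letters and the vectors. A B-letter is required
    because [w^T a x] need not be small for a lone A-letter [a]. *)
Definition word_bound r (c : R) := forall n (U : T -> 'M[C]_n.+1), rot_inv U ->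
  forall es w x, (size es <= r)%N -> alternates es -> contrs es -> centered es ->
  has fst es -> sqn w <= 1 -> sqn x <= 1 -> Ex P (word4 U es w x) <= c / n.+1%:R ^+ 2.

(** A word with a B-letter is handled by averaging over basis vectors; an alternating word without
    one is a single A-letter, of trace 0 by centring. *)
Lemma trace_bound r c : 0 <= c -> word_bound r c ->
  forall n (U : T -> 'M[C]_n.+1), rot_inv U ->
  forall es, (0 < size es <= r)%N -> alternates es -> contrs es -> centered es ->
  Ex P (trace4 U es) <= c / n.+1%:R ^+ 2.
Proof.
move=> c0 hc n U hU es /andP[s0 sr] ha hes h0.
have c0' : 0 <= c / n.+1%:R ^+ 2 by rewrite divr_ge0// exprn_ge0.
have [hb|hb] := boolP (has fst es).
  by apply: trace4_le => // w x hw hx; exact: hc.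
have := alternating_no_true ha hb; case: es s0 {sr ha hes hb} h0 => // e [|//] _ h0 _.
rewrite (_ : trace4 U [:: e] = fun _ => 0) ?Ex_cst//.
apply/funext => o; rewrite /trace4 /= mulmx1 ntr_letter// h0 ?mem_head//.
by rewrite cabs0 expr0n.
Qed.

(** A leading A-letter is moved onto [w] by transposition. For a leading B-letter the loop
    inequality involves traces of strictly shorter words, except for the whole word when it also
    ends with a B-letter; fusing its two ends expresses that trace by two shorter words. *)
Lemma word_bound_exists r : exists2 c, 0 <= c & word_bound r c.
Proof.
elim: r => [|r [c c0 hc]].
  by exists 0 => // n U _ [].
have [K hK] : exists K : R, 2048 <= K by exists 2048.
(* [136 = 128 + 8]: the fourth power of the sum in [ntr_merge] costs a factor 8, and the coefficient
   2 of the fused word another [2^4]. *)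
have [L hL] : exists L : R, 136 = L by exists 136.
have K0 : 0 <= K by apply: le_trans hK; exact: ler0n.
have L0 : 0 <= L by rewrite -hL; exact: ler0n.
exists (c + K * r.+1%:R ^+ 4 * (L * c) + K * r.+1%:R ^+ 2).
  by rewrite !addr_ge0 ?mulr_ge0 ?exprn_ge0.
move=> n U hU es w x hsz ha hes h0 hb hw hx.
set N : R := n.+1%:R; have N0 : 0 < N ^+ 2 by rewrite exprn_gt0 ?ltr0n.
have cN : 0 <= c / N ^+ 2 by rewrite divr_ge0// ltW.
case: es => [|[b a] es] in hsz ha hes h0 hb *; first by [].
have [/= ca ces] := (contrs_cons _ _).1 hes.
case: b => [|] in hsz ha hes h0 hb *; last first.
  rewrite (_ : word4 U _ w x = word4 U es (a^T *m w) x); last first.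
    by apply/funext => o; rewrite /word4 /= /letter /= -mulmxA dot_tr.
  apply: le_trans (hc _ _ hU _ _ _ _ _ _ _ _ _ _) _ => //.
  - by case: (es) ha => // e es' /= /andP[].
  - by move=> e he; apply: h0; rewrite inE he orbT.
  - by apply: contr_sqn => //; exact: contr_tr.
  rewrite ler_pM2r ?invr_gt0// -addrA lerDl addr_ge0 ?mulr_ge0 ?exprn_ge0//.
pose fs := (true, a) :: es; rewrite -/fs in hsz ha hes h0 hb *.
have hS gs : (0 < size gs <= r)%N -> alternates gs -> contrs gs -> centered gs ->
  Ex P (trace4 U gs) <= c / N ^+ 2 by exact: trace_bound.
have cc : c / N ^+ 2 <= L * c / N ^+ 2 by rewrite ler_pM2r ?invr_gt0// -hL; lra.
have step : Ex P (word4 U fs w x) <= K * (size fs)%:R ^+ 4 * (L * c / N ^+ 2)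
    + K * (size fs)%:R ^+ 2 / N ^+ 2.
  apply: word4_loop => //; first by rewrite -mulrA mulr_ge0.
    move=> l /andP[l0 ls]; apply: le_trans cc; apply: hS.
    - rewrite size_take ls l0 /=; exact: leq_trans ls hsz.
    - exact: take_sorted.
    - by apply: contrs_sub hes => e; exact: mem_take.
    - by move=> e /mem_take; exact: h0.
  have [e0|[mid [[b' a'] ees]]] : es = [::] \/ exists mid e, es = rcons mid e.
    by case/lastP: (es) => [|mid e]; [left|right; exists mid, e].
    move=> _; apply: le_trans cc.
    rewrite (_ : trace4 U fs = fun _ => 0) ?Ex_cst//.
    apply/funext => o; rewrite /trace4 /fs e0 /= mulmx1 ntr_letter//=.
    by rewrite (h0 (true, a)) ?mem_head// cabs0 expr0n.
  have -> : size fs = (size mid).+2 by rewrite /fs ees /= size_rcons.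
  rewrite /= ees nth_rcons ltnn eqxx /= => hb'; rewrite {}hb' in ees.
  have sm : (size mid < r)%N.
    by move: hsz; rewrite /fs ees /= size_rcons ltnS.
  have hmid e : e \in mid -> e \in fs by rewrite /fs ees inE mem_rcons inE => ->; rewrite !orbT.
  have hm : contr a' by apply: (hes (true, a')); rewrite /fs ees inE mem_rcons mem_head orbT.
  have [amid pmid] : alternates mid /\ path (fun x y => x.1 != y.1) (true, a) mid.
    move: ha; rewrite /fs ees /alternates /= rcons_path => /andP[hp _].
    by split => //; exact: path_sorted hp.
  (* Alternation forbids two adjacent B-letters, so the middle is not empty and its trace is covered
     by the induction hypothesis. *)
  have m0 : (0 < size mid)%N.
    by move: ha; rewrite /fs ees; case: (mid).
  have cmid : contrs mid by apply: contrs_sub hes.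
  have zmid : centered mid by move=> e /hmid; exact: h0.
  pose gs := (true, merged a a') :: mid.
  have cgs : contrs gs by apply/contrs_cons; split => //; exact: merged_contr.
  have b1 : Ex P (trace4 U gs) <= c / N ^+ 2.
    apply: hS => //; first by rewrite /gs; case: (mid) pmid.
    by move=> e; rewrite inE => /orP[/eqP->|]; [exact: merged_ntr|exact: zmid].
  have b2 : Ex P (trace4 U mid) <= c / N ^+ 2 by apply: hS => //; rewrite m0 ltnW.
  apply: le_trans (_ : Ex P (fun o => 128 * trace4 U gs o + 8 * trace4 U mid o) <= _).
    apply: Ex_le; first exact: trace4_bmeas.
      by apply: bmeasD; apply: bmeasZ; exact: trace4_bmeas.
    move=> o; rewrite /trace4 /fs ees (ntr_merge hU).
    apply: le_trans (cabs_add_pow4_le _ _) _.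
    rewrite cabsM (cabs_nat _ 2) exprMn cabsM exprMn mulrDr mulrA.
    apply: lerD; first by rewrite -natrX -natrM.
    rewrite ler_wpM2l// ler_piMl ?exprn_ge0 ?cabs_ge0// exprn_ile1 ?cabs_ge0//.
    by apply: ntr_contr; exact: contrM.
  have bg := trace4_bmeas hU cgs; have bm := trace4_bmeas hU cmid.
  rewrite ExD; [|exact: bmeasZ|exact: bmeasZ]; rewrite !ExZ//.
  have -> : L * c / N ^+ 2 = 128 * (c / N ^+ 2) + 8 * (c / N ^+ 2) by rewrite -hL; ring.
  by apply: lerD; rewrite ler_wpM2l.
apply: le_trans step _; rewrite -/N.
have hs : (size fs)%:R <= r.+1%:R :> R by rewrite ler_nat.
rewrite !mulrDl -addrA; apply: ler_wpDl => //; apply: lerD.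
  rewrite mulrA ler_pM2r ?invr_gt0// ler_wpM2r ?mulr_ge0// ler_wpM2l//.
  by rewrite lerXn2r ?nnegrE.
by rewrite ler_pM2r ?invr_gt0// ler_wpM2l// lerXn2r ?nnegrE.
Qed.

End RandomWords.

(** * Almost sure convergence and growth of operator norms *)

Section ComplexLimits.
Variable R : realType.
Local Notation C := R[i].
Implicit Types (u : nat -> C) (l : C).

Lemma cvgC_cst (c : C) : cvgC (fun _ => c) c.
Proof. by split; exact: cvg_cst. Qed.

Lemma cvgCD u u' l l' : cvgC u l -> cvgC u' l' -> cvgC (fun N => u N + u' N) (l + l').
Proof.
move=> [a b] [a' b']; split.
  by rewrite cReD; under eq_fun do rewrite cReD; exact: cvgD.
by rewrite cImD; under eq_fun do rewrite cImD; exact: cvgD.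
Qed.

Lemma cvgCM u u' l l' : cvgC u l -> cvgC u' l' -> cvgC (fun N => u N * u' N) (l * l').
Proof.
move=> [a b] [a' b']; split.
  by rewrite cReM; under eq_fun do rewrite cReM; apply: cvgB; exact: cvgM.
by rewrite cImM; under eq_fun do rewrite cImM; apply: cvgD; exact: cvgM.
Qed.

Lemma cvgC_sum (I : Type) (r : seq I) (f : I -> nat -> C) (l : I -> C) :
  (forall i, cvgC (f i) (l i)) -> cvgC (fun N => \sum_(i <- r) f i N) (\sum_(i <- r) l i).
Proof.
move=> h; elim: r => [|i r IH].
  by rewrite big_nil; under eq_fun do rewrite big_nil; exact: cvgC_cst.
by rewrite big_cons; under eq_fun do rewrite big_cons; exact: cvgCD.
Qed.

Lemma cvgC_unique u l l' : cvgC u l -> cvgC u l' -> l = l'.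
Proof.
move=> [a b] [a' b']; apply/eqP; rewrite eq_complex; apply/andP; split; apply/eqP.
  exact: cvg_unique a a'.
exact: cvg_unique b b'.
Qed.

Lemma cvgC_bounded u l : cvgC u l -> exists K, forall N, cabs (u N) <= K.
Proof.
move=> [a b].
have [K [_ hK]] := cvg_seq_bounded (cvgP _ a).
have [L [_ hL]] := cvg_seq_bounded (cvgP _ b).
exists ((K + 1) + (L + 1)) => N.
have h1 : `|complex.Re (u N)| <= K + 1 by apply: (hK (K + 1)) => //; rewrite ltrDl.
have h2 : `|complex.Im (u N)| <= L + 1 by apply: (hL (L + 1)) => //; rewrite ltrDl.
apply: le_trans (lerD h1 h2).
rewrite -(@ler_pXn2r _ 2) ?nnegrE ?cabs_ge0 ?addr_ge0// sqr_cabs sqrrD !real_normK ?num_real//.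
by rewrite lerD2r lerDl mulrn_wge0// mulr_ge0.
Qed.

Lemma cvgC_ext u u' l : (forall N, u N = u' N) -> cvgC u l -> cvgC u' l.
Proof. by move=> /funext ->. Qed.

Lemma cvgC_pow4 u : (fun N => cabs (u N) ^+ 4) @ \oo --> (0 : R) -> cvgC u 0.
Proof.
move=> h.
have key (f : nat -> R) : (forall N, `|f N| <= cabs (u N)) -> f @ \oo --> (0 : R).
  move=> hf; apply/cvgr0Pnorm_lt => e e0.
  have e4 : 0 < e ^+ 4 by rewrite exprn_gt0.
  have /cvgr0Pnorm_lt/(_ _ e4) := h; apply: filterS => N.
  rewrite ger0_norm ?exprn_ge0 ?cabs_ge0// => hN.
  apply: le_lt_trans (hf N) _.
  by rewrite -(@ltr_pXn2r _ 4) ?nnegrE ?cabs_ge0 ?ltW.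
split; apply: key => N; rewrite cabsE -sqrtr_sqr ler_wsqrtr//.
  by rewrite lerDl sqr_ge0.
by rewrite lerDr sqr_ge0.
Qed.

End ComplexLimits.

(** * From summable means to almost sure convergence *)

Section BorelCantelli.
Context {d : measure_display} {T : measurableType d} {R : realType} (P : probability T R).

(** Telescoping: with [a^2 = n + 1] and [b^2 = n + 2], [1 / a^3 <= 6 / a - 6 / b] follows from
    [b (a + b) <= 6 a^2]; the constant 6 is generous. *)
Lemma sum_inv_pow32 (n : nat) :
  \sum_(0 <= N < n) (N.+1%:R * Num.sqrt N.+1%:R : R)^-1 <= 6 - 6 / Num.sqrt n.+1%:R.
Proof.
elim: n => [|n IH].
  by rewrite big_nil sqrtr1; lra.
rewrite big_nat_recr//=; apply: le_trans (lerD IH (lexx _)) _.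
set a := Num.sqrt n.+1%:R; set b := Num.sqrt n.+2%:R.
have a0 : 0 < a by rewrite sqrtr_gt0 ltr0n.
have b0 : 0 < b by rewrite sqrtr_gt0 ltr0n.
have ea : n.+1%:R = a ^+ 2 by rewrite sqr_sqrtr.
have eb : b ^+ 2 = a ^+ 2 + 1 by rewrite -ea sqr_sqrtr// -natr1.
have a1 : 1 <= a ^+ 2 by rewrite -ea ler1n.
rewrite ea; suff h : (a ^+ 2 * a)^-1 <= 6 / a - 6 / b by lra.
have hb : b <= 6 * a ^+ 2 * (b - a).
  rewrite -(@ler_pM2r _ (a + b)) ?addr_gt0//.
  have -> : 6 * a ^+ 2 * (b - a) * (a + b) = 6 * a ^+ 2 * (b ^+ 2 - a ^+ 2) by ring.
  rewrite eb; have := sqr_ge0 (a - b); rewrite sqrrB eb mulrDr -expr2 eb; lra.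
have -> : 6 / a - 6 / b = (6 * a ^+ 2 * (b - a)) / b / (a ^+ 2 * a).
  by field; rewrite !gt_eqF.
rewrite -[leLHS]mul1r ler_pM2r ?invr_gt0 ?mulr_gt0 ?exprn_gt0//.
by rewrite ler_pdivlMr// mul1r.
Qed.

(** By monotone convergence the sum over [N] has finite mean, so it is almost surely finite and its
    terms tend to 0. *)
Lemma ae_cvg0_of_mean (f : nat -> T -> R) (C : R) : (forall N w, 0 <= f N w) ->
  (forall N, bmeas (f N)) ->
  (forall N, Ex P (f N) <= C * (N.+1%:R * Num.sqrt N.+1%:R)^-1) ->
  {ae P, forall w, (fun N => f N w) @ \oo --> (0 : R)}.
Proof.
move=> f0 bf hC.
have C0 : 0 <= C.
  have := hC 0%N; rewrite sqrtr1 mulr1 invr1 mulr1; apply: le_trans.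
  by apply: Rintegral_ge0.
have mf N : measurable_fun setT (EFin \o f N) by apply/measurable_EFinP; have [] := bf N.
have intE N : (\int[P]_w (f N w)%:E)%E = (Ex P (f N))%:E.
  rewrite /Ex /Rintegral fineK//.
  have hi := bmeas_integrable P (bf N).
  exact: (integrable_fin_num measurableT hi).
pose g w := (\sum_(N <oo) (f N w)%:E)%E.
have gi : (\int[P]_w g w < +oo)%E.
  rewrite integral_nneseries//; last by move=> N w _; rewrite lee_fin.
  apply: (@le_lt_trans _ _ (C * 6)%:E); last exact: ltry.
  apply: lime_le; first by apply: is_cvg_nneseries => N _ _; rewrite integral_ge0// => w _; rewrite lee_fin.
  apply: nearW => n; rewrite (eq_bigr (fun N => (Ex P (f N))%:E)); last by move=> N _; rewrite intE.
  rewrite sumEFin lee_fin.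
  apply: le_trans (ler_sum _ (fun N _ => hC N)) _; rewrite -mulr_sumr ler_wpM2l//.
  apply: le_trans (sum_inv_pow32 n) _.
  by rewrite lerBlDr lerDl divr_ge0// sqrtr_ge0.
have g0 w : (0 <= g w)%E by apply: nneseries_ge0 => N _ _; rewrite lee_fin.
have mg : measurable_fun setT g.
  by apply: ge0_emeasurable_sum => [N w _ _|N _]; [rewrite lee_fin; exact: f0|exact: mf].
have ig : P.-integrable setT g.
  apply/integrableP; split => //.
  by under eq_integral do rewrite gee0_abs//.
have := integrable_ae measurableT ig; apply: filterS => w /(_ I) hw.
apply: cvg_series_cvg_0.
apply: nondecreasing_is_cvgn.
  by move=> m n mn; rewrite /series /= [leRHS](big_cat_nat (leq0n m) mn)/= lerDl sumr_ge0.
exists (fine (g w)) => _ [n _ <-].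
rewrite -lee_fin fineK// /series /= -sumEFin.
by apply: nneseries_lim_ge => N _ _; rewrite lee_fin.
Qed.

End BorelCantelli.

(** * Removing the null set where unitarity fails *)

Section Regularisation.
Context {d : measure_display} {T : measurableType d} {R : realType} (P : probability T R).
Variables (n : nat) (realc : bool) (U : T -> 'M[R[i]]_n).
Hypothesis hU : haar P realc U.

Let mU : mmeas U.
Proof. by have [a [b _]] := hU; move=> i j; split. Qed.

Let E : set T := [set w | unitary (U w)].

Let mE : measurable E.
Proof.
(* The zero matrix is a box with singleton sides, so measurability of boxes applies. *)
have -> : E = (fun w => mxadj (U w) *m U w + - 1%:M) @^-1`
    box (fun _ _ => [set 0]) (fun _ _ => [set 0]).
  apply/seteqP; split => w; rewrite /E /unitary /=.
    by move=> -> i j; rewrite subrr mxE.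
  move=> h; apply/eqP; rewrite -subr_eq0; apply/eqP/matrixP => i j.
  apply/eqP; rewrite eq_complex [(0 : 'M[R[i]]_n) i j]mxE.
  by have [-> ->] := h i j; rewrite !eqxx.
apply: preimage_box => [|i j|i j]; [|exact: measurable_set1|exact: measurable_set1].
apply: mmeasD; last exact: mmeas_cst.
by apply: mmeasM => //; exact: mmeas_adj.
Qed.

Let PE : P (~` E) = 0%E.
Proof.
apply: measure_negligible; first exact: measurableC.
have [_ [_ [h _]]] := hU; move: h; apply: negligibleS => w /= h1 h2; apply: h1.
by case: h2.
Qed.

Definition regularise (w : T) : 'M[R[i]]_n := if `[< unitary (U w) >] then U w else 1%:M.

Lemma regularise_ae : {ae P, forall w, regularise w = U w}.
Proof.
have [_ [_ [h _]]] := hU; apply: filterS h => w [h _].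
by rewrite /regularise asboolT.
Qed.

Let regE w : E w -> regularise w = U w.
Proof. by move=> h; rewrite /regularise asboolT. Qed.

Lemma regularise_unitary w : unitary (regularise w).
Proof.
rewrite /regularise; case: asboolP => // _.
by rewrite /unitary /mxadj map_mx1 trmx1 mulmx1.
Qed.

Lemma regularise_meas : mmeas regularise.
Proof.
move=> i j.
have key (f : T -> R) (c : R) : measurable_fun setT f ->
    measurable_fun setT (fun w => if w \in E then f w else c).
  move=> mf; apply: measurable_fun_ifT => //.
  apply: (@measurable_fun_bool _ _ _ _ true).
  by rewrite (_ : _ @^-1` _ = E) ?setTI//; apply/seteqP; split => w /=; [exact: set_mem|exact: mem_set].
have [m1 m2] := mU i j.
have e w : regularise w i j = if w \in E then U w i j else 1%:M i j.
  have -> : (w \in E) = `[< unitary (U w) >].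
    by apply/idP/asboolP => [/set_mem//|h]; exact: mem_set.
  by rewrite /regularise; case: asboolP.
split.
  have := key _ (complex.Re ((1%:M : 'M[R[i]]_n) i j)) m1.
  by apply: eq_measurable_fun => w _; rewrite e; case: ifP.
have := key _ (complex.Im ((1%:M : 'M[R[i]]_n) i j)) m2.
by apply: eq_measurable_fun => w _; rewrite e; case: ifP.
Qed.

Let eqP_on (A B : set T) : measurable A -> measurable B -> A `&` E = B `&` E -> P A = P B.
Proof.
have h (D : set T) : measurable D -> P D = P (D `&` E).
  move=> mD; rewrite (measureDI P mD mE) [X in (X + _)%E = _](_ : _ = 0%E) ?add0e//.
  apply/eqP; rewrite -measure_le0; apply: (@le_trans _ _ (P (~` E))); last by rewrite PE.
  apply: le_measure => [| |w []//]; rewrite inE; [exact: measurableD|exact: measurableC].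
by move=> mA mB e; rewrite (h A)// (h B)// e.
Qed.

(** On the full-measure event [E] the regularised matrix is [U], so every box event keeps its
    probability and the invariance of [U] carries over. *)
Lemma regularise_rot_inv : rot_inv P regularise.
Proof.
split; [exact: regularise_unitary|exact: regularise_meas|].
move=> V uV rV Bre Bim m1 m2.
have mVU : mmeas (fun w => V *m U w) by apply: mmeasM => //; exact: mmeas_cst.
have mVr : mmeas (fun w => V *m regularise w).
  by apply: mmeasM; [exact: mmeas_cst|exact: regularise_meas].
have [_ [_ [_ hinv]]] := hU.
have e1 : P (regularise @^-1` box Bre Bim) = P (U @^-1` box Bre Bim).
  apply: eqP_on; [apply: preimage_box => //; exact: regularise_meas|exact: preimage_box|].
  by apply/seteqP; split=> w [h1 h2]; split => //; move: h1; rewrite /= regE.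
have e2 : P ((fun w => V *m regularise w) @^-1` box Bre Bim) =
    P ((fun w => V *m U w) @^-1` box Bre Bim).
  apply: eqP_on; [exact: preimage_box|exact: preimage_box|].
  by apply/seteqP; split=> w [h1 h2]; split => //; move: h1; rewrite /= regE.
rewrite e1 e2; exact: (hinv V (conj uV (fun _ => rV)) Bre Bim m1 m2).
Qed.

End Regularisation.

(** * Operator norms growing more slowly than any power of the dimension *)

Section Growth.
Variable R : realType.
Local Notation C := R[i].

(** Here [k] bounds the square of the operator norm, which is why square roots of [k] appear in
    rescalings. *)
Definition opb (n : nat) (M : 'M[C]_n) (k : R) := forall x, sqn (M *m x) <= k * sqn x.

Lemma opbM n (M M' : 'M[C]_n) k k' : 0 <= k -> opb M k -> opb M' k' -> opb (M *m M') (k * k').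
Proof.
move=> k0 h h' x; rewrite -mulmxA; apply: le_trans (h _) _.
by rewrite -mulrA ler_wpM2l.
Qed.

Lemma sqnD_le n (x y : 'cV[C]_n) : sqn (x + y) <= 2 * sqn x + 2 * sqn y.
Proof.
rewrite /sqn !mulr_sumr -big_split /=; apply: ler_sum => i _; rewrite mxE.
have := cabsD (x i 0) (y i 0); set u := cabs (x i 0); set v := cabs (y i 0) => h.
have h2 : cabs (x i 0 + y i 0) ^+ 2 <= (u + v) ^+ 2.
  by rewrite lerXn2r ?nnegrE ?addr_ge0 ?cabs_ge0.
by have := sqr_ge0 (u - v); move: h2; rewrite !expr2; lra.
Qed.

Lemma opbD n (M M' : 'M[C]_n) k k' : 1 <= k -> 1 <= k' -> opb M k -> opb M' k' ->
  opb (M + M') (4 * (k * k')).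
Proof.
move=> k1 k1' h h' x; rewrite mulmxDl; apply: le_trans (sqnD_le _ _) _.
have s0 := sqn_ge0 x.
have a : sqn (M *m x) <= k * k' * sqn x.
  by apply: le_trans (h x) _; rewrite ler_wpM2r// ler_peMr//; lra.
have b : sqn (M' *m x) <= k * k' * sqn x.
  by apply: le_trans (h' x) _; rewrite ler_wpM2r// ler_peMl//; lra.
lra.
Qed.

Lemma opb_contr n (M : 'M[C]_n) k : 0 < k -> opb M k -> contr ((Num.sqrt k)^-1%:C *: M).
Proof.
move=> k0 h x; rewrite -scalemxAl sqnZ cabs_real ger0_norm ?invr_ge0 ?sqrtr_ge0//.
by rewrite exprVn sqr_sqrtr ?(ltW k0)// ler_pdivrMl.
Qed.

(* Slower than every power of the dimension. *)
Definition subpoly (a : forall N, 'M[C]_N.+1) := forall m, exists K (k : nat -> R),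
  forall N, [/\ 1 <= k N, k N ^+ m <= K * N.+1%:R & opb (a N) (k N)].

(** Arithmetic-geometric inequality for [x^m] and [y^m]. Doubling the exponent in the hypotheses is
    harmless, since [subpoly] quantifies over all exponents. *)
Lemma pow_prod_le (x y : R) m K L N : 0 <= x -> 0 <= y ->
  x ^+ (2 * m) <= K * N -> y ^+ (2 * m) <= L * N -> (x * y) ^+ m <= (K + L) * N.
Proof.
move=> x0 y0; rewrite mulnC !exprM exprMn mulrDl => h1 h2.
have := sqr_ge0 (x ^+ m - y ^+ m); have := sqr_ge0 (x ^+ m + y ^+ m).
rewrite !expr2 in h1 h2 *; nra.
Qed.

Lemma subpolyM a b : subpoly a -> subpoly b -> subpoly (fun N => a N *m b N).
Proof.
move=> ha hb m; have [K [k hk]] := ha (2 * m)%N; have [L [l hl]] := hb (2 * m)%N.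
exists (K + L), (fun N => k N * l N) => N.
have [a1 a2 a3] := hk N; have [b1 b2 b3] := hl N.
split; first by rewrite mulr_ege1.
  by apply: pow_prod_le => //; lra.
by apply: opbM => //; lra.
Qed.

Lemma subpolyD a b : subpoly a -> subpoly b -> subpoly (fun N => a N + b N).
Proof.
move=> ha hb m; have [K [k hk]] := ha (2 * m)%N; have [L [l hl]] := hb (2 * m)%N.
exists (4 ^+ m * (K + L)), (fun N => 4 * (k N * l N)) => N.
have [a1 a2 a3] := hk N; have [b1 b2 b3] := hl N.
have kl : 1 <= k N * l N by rewrite mulr_ege1.
split; [lra| |exact: opbD].
rewrite exprMn -mulrA ler_wpM2l ?exprn_ge0//.
by apply: pow_prod_le => //; lra.
Qed.

Lemma subpoly_scalar (c : nat -> C) (K : R) : (forall N, cabs (c N) <= K) ->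
  subpoly (fun N => (c N)%:M).
Proof.
move=> h m; exists ((1 + K ^+ 2) ^+ m), (fun _ => 1 + K ^+ 2) => N.
have K0 := sqr_ge0 K.
split; first lra.
  by rewrite ler_peMr ?exprn_ge0 ?ler1n//; lra.
move=> x; rewrite mul_scalar_mx sqnZ ler_wpM2r ?sqn_ge0//.
have : cabs (c N) ^+ 2 <= K ^+ 2.
  rewrite lerXn2r ?nnegrE ?cabs_ge0//; exact: le_trans (cabs_ge0 _) (h N).
lra.
Qed.

Lemma subpoly_eq a b : (forall N, a N = b N) -> subpoly a -> subpoly b.
Proof.
by move=> e h m; have [K [k hk]] := h m; exists K, k => N; rewrite -e.
Qed.

Lemma subpoly_sum (I : Type) (r : seq I) (a : I -> forall N, 'M[C]_N.+1) :
  (forall i, subpoly (a i)) -> subpoly (fun N => \sum_(i <- r) a i N).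
Proof.
move=> h; elim: r => [|i r IH].
  apply: (@subpoly_eq (fun N => 0%:M)); first by move=> N; rewrite big_nil raddf0.
  by apply: (@subpoly_scalar (fun _ => 0) 0) => N; rewrite cabs0.
apply: (subpoly_eq _ (subpolyD (h i) IH)) => N.
by rewrite big_cons.
Qed.

Lemma subpolyX a k : subpoly a -> subpoly (fun N => a N ^+ k).
Proof.
move=> h; elim: k => [|k IH].
  by apply: (@subpoly_scalar (fun _ => 1) 1) => N; rewrite cabs1.
by apply: (subpoly_eq _ (subpolyM h IH)) => N; rewrite exprS.
Qed.

(** The trace is the squared Hilbert-Schmidt norm; Cauchy-Schwarz is applied row by row. *)
Lemma sqn_trace n (M : 'M[C]_n) x : sqn (M *m x) <= cabs (\tr (mxadj M *m M)) * sqn x.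
Proof.
have -> : \tr (mxadj M *m M) = (\sum_i \sum_j cabs (M i j) ^+ 2)%:C.
  rewrite mxtrace_mulC rmorph_sum; apply: eq_bigr => i _.
  by rewrite mxE rmorph_sum; apply: eq_bigr => j _; rewrite !mxE mulcJ.
rewrite cabs_real ger0_norm; last first.
  by apply: sumr_ge0 => i _; apply: sumr_ge0 => j _; rewrite sqr_ge0.
rewrite {1}/sqn mulr_suml; apply: ler_sum => i _.
have := dot_CS ((row i M)^T) x; rewrite /dot mxE.
rewrite (eq_bigr (fun j => M i j * x j 0)); last by move=> j _; rewrite !mxE.
by rewrite {1}/sqn (eq_bigr (fun j => cabs (M i j) ^+ 2))// => j _; rewrite !mxE.
Qed.

Lemma hermitianX n (A : 'M[C]_n.+1) k : Defs.hermitian A -> Defs.hermitian (A ^+ k).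
Proof.
rewrite /Defs.hermitian => h; elim: k => [|k IH]; first by apply/matrixP => i j; rewrite !mxE rmorph_nat eq_sym.
by rewrite exprSr [LHS]mxadjM h IH -[RHS]exprSr exprS.
Qed.

(* Iterating Cauchy-Schwarz: |Ax|^(2^j) <= |A^(2^j) x| for |x| <= 1. *)
Lemma hermitian_pow n (A : 'M[C]_n.+1) x j : Defs.hermitian A -> sqn x <= 1 ->
  sqn (A *m x) ^+ (2 ^ j) <= cabs (\tr (A ^+ (2 ^ j.+1))).
Proof.
move=> hA hx; apply: (@le_trans _ _ (sqn (A ^+ (2 ^ j) *m x))); last first.
  apply: le_trans (sqn_trace _ _) _; rewrite (hermitianX _ hA).
  by rewrite expnS mul2n -addnn exprD ler_piMr ?cabs_ge0.
elim: j => [|j IH]; first by rewrite expn0 !expr1.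
rewrite expnSr exprM; apply: le_trans (_ : sqn (A ^+ (2 ^ j) *m x) ^+ 2 <= _).
  by rewrite lerXn2r ?nnegrE ?exprn_ge0 ?sqn_ge0.
set B := A ^+ (2 ^ j); have hB : mxadj B = B by exact: hermitianX.
have e : sqn (B *m x) = cabs (inner (A ^+ (2 ^ j * 2) *m x) x).
  rewrite exprM -/B expr2 -[B * B]/(B *m B) -mulmxA inner_adj hB sqn_inner.
  by rewrite cabs_real ger0_norm ?sqn_ge0.
rewrite e innerE; apply: le_trans (dot_CS _ _) _.
by rewrite sqn_conj ler_piMl ?sqn_ge0.
Qed.

(** The trace of [A^(2^(m+1))] is [O(N)] and dominates the [2^m]-th power of the squared norm.
    Adding 1 to it makes its root [k N] at least 1, and [m <= 2^m] then gives the requested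
    exponent. *)
Lemma subpoly_hermitian (A : forall N, 'M[C]_N.+1) :
  (forall N, Defs.hermitian (A N)) ->
  (forall k, exists l, cvgC (fun N => ntr (A N ^+ k)) l) -> subpoly A.
Proof.
move=> hA hk m.
have [l /cvgC_bounded[K hK]] := hk (2 ^ m.+1)%N.
pose t N := 1 + cabs (\tr (A N ^+ (2 ^ m.+1))).
have t1 N : 1 <= t N by rewrite /t lerDl cabs_ge0.
pose p : R := (2 ^ m)%:R.
have p0 : p != 0 by rewrite pnatr_eq0 expn_eq0.
pose k N := t N `^ p^-1.
have kp N : k N ^+ (2 ^ m) = t N.
  by rewrite -powR_mulrn ?powR_ge0// -powRrM mulVf// powRr1//; have := t1 N; lra.
have k1 N : 1 <= k N.
  rewrite -(@ler_pXn2r _ (2 ^ m)) ?expn_gt0// ?nnegrE ?powR_ge0 ?ler01//.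
  by rewrite kp expr1n.
exists (1 + K), k => N; split => //.
  apply: le_trans (_ : k N ^+ (2 ^ m) <= _).
    by apply: ler_weXn2l => //; rewrite ltnW// ltn_expl.
  rewrite kp /t mulrDl mul1r lerD// ?ler1n//.
  have -> : \tr (A N ^+ (2 ^ m.+1)) = N.+1%:R * ntr (A N ^+ (2 ^ m.+1)).
    by rewrite /ntr mulrC divfK// pnatr_eq0.
  by rewrite cabsM cabs_nat mulrC ler_wpM2r.
move=> x.
have unit y : sqn y <= 1 -> sqn (A N *m y) <= k N.
  move=> hy; rewrite -(@ler_pXn2r _ (2 ^ m)) ?expn_gt0// ?nnegrE ?powR_ge0 ?sqn_ge0//.
  by rewrite kp; apply: le_trans (hermitian_pow m (hA N) hy) _; rewrite lerDr.
have := sqn_ge0 x; rewrite le_eqVlt => /orP[/eqP e|x0].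
  have := sqn_trace (A N) x; rewrite -e !mulr0; apply: le_trans.
  by rewrite lexx.
have s0 : 0 < Num.sqrt (sqn x) by rewrite sqrtr_gt0.
have := unit ((Num.sqrt (sqn x))^-1%:C *: x).
rewrite -scalemxAr !sqnZ cabs_real ger0_norm ?invr_ge0 ?sqrtr_ge0//.
rewrite exprVn sqr_sqrtr ?(ltW x0)// mulVf ?gt_eqF// lexx => /(_ isT).
by rewrite mulrC ler_pdivrMr.
Qed.

End Growth.

(** * Limits of words in polynomial letters *)

Section PolynomialLetters.
Context {d : measure_display} {T : measurableType d} {R : realType} (P : probability T R).
Local Notation C := R[i].
Variables (A B : forall N : nat, 'M[C]_N.+1) (v : forall N : nat, 'cV[C]_N.+1).
Variable U : forall N : nat, T -> 'M[C]_N.+1.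
Hypotheses (hA : forall N, Defs.hermitian (A N)) (hB : forall N, Defs.hermitian (B N)).
Hypothesis hv : forall N, sqn (v N) = 1.
Hypothesis mA : forall k, exists l, cvgC (fun N => ntr (A N ^+ k)) l.
Hypothesis mv : forall k, exists l, cvgC (fun N => inner (A N ^+ k *m v N) (v N)) l.
Hypothesis mB : forall k, exists l, cvgC (fun N => ntr (B N ^+ k)) l.
Hypothesis hU : forall N, rot_inv P (U N).

(* A letter is a polynomial in A (false) or in U B U^* (true) whose
   coefficients may depend on the dimension; this makes exact centring possible. *)
Definition pletter := (bool * (nat -> {poly C}))%type.
Implicit Types (e f : pletter) (es : seq pletter).

Definition base (b : bool) N := if b then B N else A N.
Definition pmx e N : 'M[C]_N.+1 := horner_mx (base e.1 N) (e.2 N).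
(** Bounded degree and convergent coefficients make the traces of the letter converge and its norm
    subpolynomial, and they survive centring and products. *)
Definition good e := (exists D, forall N, (size (e.2 N) <= D)%N) /\
  forall k, exists l, cvgC (fun N => (e.2 N)`_k) l.

Fixpoint Forall (Q : pletter -> Prop) es := if es is e :: es' then Q e /\ Forall Q es' else True.

Lemma Forall_cat Q es fs : Forall Q (es ++ fs) <-> Forall Q es /\ Forall Q fs.
Proof. by elim: es => [|e es IH] /=; [tauto|rewrite IH; tauto]. Qed.

Lemma horner_mx_expand n (M : 'M[C]_n.+1) (p : {poly C}) D : (size p <= D)%N ->
  horner_mx M p = \sum_(k < D) p`_k *: M ^+ k.
Proof.
move=> h; have {1}-> : p = \sum_(k < D) p`_k *: 'X^k.
  by rewrite -poly_def; apply/polyP => i; rewrite coef_poly; case: ltnP => // /(leq_trans h)/(nth_default 0).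
rewrite rmorph_sum; apply: eq_bigr => k _ /=.
by rewrite horner_mxZ rmorphXn /= horner_mx_X.
Qed.

Lemma good_expand e : good e -> exists D, forall N,
  pmx e N = \sum_(k < D) (e.2 N)`_k *: base e.1 N ^+ k.
Proof. by move=> [[D hD] _]; exists D => N; apply: horner_mx_expand. Qed.

Lemma base_subpoly b : subpoly (base b).
Proof. by case: b; [exact: (subpoly_hermitian hB mB)|exact: (subpoly_hermitian hA mA)]. Qed.

Lemma base_trace b k : exists l, cvgC (fun N => ntr (base b N ^+ k)) l.
Proof. by case: b. Qed.

Lemma good_subpoly e : good e -> subpoly (pmx e).
Proof.
move=> he; have [D hD] := good_expand he; have [_ hc] := he.
apply: (@subpoly_eq _ (fun N => \sum_(k < D) (e.2 N)`_k *: base e.1 N ^+ k)) => [N|].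
  by rewrite hD.
apply: subpoly_sum => k.
apply: (@subpoly_eq _ (fun N => ((e.2 N)`_k)%:M *m base e.1 N ^+ k)) => [N|].
  by rewrite mul_scalar_mx.
have [l /cvgC_bounded[K hK]] := hc k.
by apply: subpolyM; [exact: subpoly_scalar hK|exact/subpolyX/base_subpoly].
Qed.

Lemma ntr_sum n (I : Type) (r : seq I) (F : I -> 'M[C]_n.+1) :
  ntr (\sum_(i <- r) F i) = \sum_(i <- r) ntr (F i).
Proof. by rewrite /ntr linear_sum mulr_suml. Qed.

Lemma good_trace e : good e -> exists l, cvgC (fun N => ntr (pmx e N)) l.
Proof.
move=> he; have [D hD] := good_expand he; have [_ hc] := he.
have [l hl] := choice hc; have [t ht] := choice (base_trace e.1).
exists (\sum_(k < D) l k * t k).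
under eq_fun do rewrite hD ntr_sum; apply: cvgC_sum => k.
by under eq_fun do rewrite ntrZ; exact: cvgCM.
Qed.

Lemma inner_suml n (I : Type) (r : seq I) (F : I -> 'cV[C]_n) y :
  inner (\sum_(i <- r) F i) y = \sum_(i <- r) inner (F i) y.
Proof.
by rewrite innerE dot_sumr; apply: eq_bigr => i _; rewrite innerE.
Qed.

Lemma good_inner e : good e -> e.1 = false ->
  exists l, cvgC (fun N => inner (pmx e N *m v N) (v N)) l.
Proof.
move=> he e1; have [D hD] := good_expand he; have [_ hc] := he.
have [l hl] := choice hc; have [t ht] := choice mv.
exists (\sum_(k < D) l k * t k).
under eq_fun do rewrite hD mulmx_suml inner_suml e1; apply: cvgC_sum => k.
by under eq_fun do rewrite -scalemxAl innerE dotZr -innerE; exact: cvgCM.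
Qed.

Definition pcenter e : pletter := (e.1, fun N => e.2 N - (ntr (pmx e N))%:P).
Definition pmerge e f : pletter := (e.1, fun N => e.2 N * f.2 N).

Lemma pmx_center e N : pmx (pcenter e) N = pmx e N - (ntr (pmx e N))%:M.
Proof. by rewrite {1}/pmx rmorphB /= horner_mx_C. Qed.

Lemma ntr_pcenter e N : ntr (pmx (pcenter e) N) = 0.
Proof. by rewrite pmx_center -scaleN1r ntrD ntrZ ntr_scalar mulN1r subrr. Qed.

Lemma good_center e : good e -> good (pcenter e).
Proof.
move=> he; have [t ht] := good_trace he; have [[D hD] hc] := he; split.
  exists (maxn D 1) => N /=; apply: leq_trans (size_polyD _ _) _.
  by rewrite size_polyN geq_max !leq_max hD size_polyC_leq1 orbT.
move=> k; have [l hl] := hc k; exists (l + -1 * (if k == 0%N then t else 0)).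
under eq_fun do rewrite /= coefB coefC -mulN1r.
apply: cvgCD => //; apply: cvgCM; first exact: cvgC_cst.
by case: (k == 0%N) => //; exact: cvgC_cst.
Qed.

Lemma good_merge e f : good e -> good f -> good (pmerge e f).
Proof.
move=> [[D hD] hc] [[E hE] hf]; split.
  exists (D + E)%N => N /=; apply: leq_trans (size_polyMleq _ _) _.
  by apply: leq_trans (leq_pred _) _; exact: leq_add.
have [l hl] := choice hc; have [t ht] := choice hf.
move=> k; exists (\sum_(j < k.+1) l j * t (k - j)%N).
under eq_fun do rewrite /= coefM.
by apply: cvgC_sum => j; exact: cvgCM.
Qed.

Definition plist es N := [seq (e.1, pmx e N) | e <- es].
Definition Xmx es N (w : T) : 'M[C]_N.+1 := mword (U N w) (plist es N).
Definition Xtr es N (w : T) := ntr (Xmx es N w).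
Definition Xin es N (w : T) := inner (Xmx es N w *m v N) (v N).

Lemma Xmx_cat es fs N w : Xmx (es ++ fs) N w = Xmx es N w *m Xmx fs N w.
Proof. by rewrite /Xmx /plist map_cat mword_cat. Qed.

Lemma Xmx_merge es e f fs N w : e.1 = f.1 ->
  Xmx (es ++ e :: f :: fs) N w = Xmx (es ++ pmerge e f :: fs) N w.
Proof.
move=> ef; rewrite !Xmx_cat; congr (_ *m _); rewrite /Xmx /= mulmxA; congr (_ *m _).
have hm : pmx (pmerge e f) N = pmx e N *m pmx f N.
  by rewrite /pmx /= rmorphM /= ef.
rewrite /letter /= hm -ef; case: e.1 => //.
have [h _ _] := hU N.
rewrite -!mulmxA; congr (_ *m (_ *m _)).
by rewrite (mulmxA (mxadj _)) h mul1mx.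
Qed.

Lemma Xmx_center es e fs N w : Xmx (es ++ e :: fs) N w =
  Xmx (rcons es (pcenter e) ++ fs) N w + ntr (pmx e N) *: Xmx (es ++ fs) N w.
Proof.
have [h _ _] := hU N.
rewrite cat_rcons !Xmx_cat scalemxAr -mulmxDr; congr (_ *m _).
have -> : Xmx (e :: fs) N w = letter (U N w) (e.1, pmx e N) *m Xmx fs N w by [].
have -> : Xmx (pcenter e :: fs) N w =
  letter (U N w) (e.1, pmx (pcenter e) N) *m Xmx fs N w by [].
suff -> : letter (U N w) (e.1, pmx e N) =
    letter (U N w) (e.1, pmx (pcenter e) N) + (ntr (pmx e N))%:M.
  by rewrite mulmxDl mul_scalar_mx.
rewrite /letter /= pmx_center; case: e.1; last by rewrite subrK.
rewrite mulmxBr mulmxBl mul_mx_scalar -scalemxAl (unitary_mulVr (h w)).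
by rewrite scalemx1 subrK.
Qed.

(** Dividing each letter by the square root of its [opb] bound gives a word in centred contractions
    with the same pattern; the product of the bounds is still subpolynomial. *)
Lemma pscale es : Forall good es -> (Forall (fun e => forall N, ntr (pmx e N) = 0) es) ->
  forall m, exists K (k : nat -> R), forall N, [/\ 1 <= k N, k N ^+ m <= K * N.+1%:R &
    exists ss : seq (bool * 'M[C]_N.+1), [/\ contrs ss, centered ss,
      map fst ss = map fst es &
      forall Z, mword Z (plist es N) = (Num.sqrt (k N))%:C *: mword Z ss]].
Proof.
elim: es => [_ _ m|e es IH [he hes] [h0 h0s] m].
  exists 1, (fun _ => 1) => N; split => //; first by rewrite expr1n mul1r ler1n.
  by exists [::]; split => // Z; rewrite sqrtr1 scale1r.
have [K [k hk]] := IH hes h0s (2 * m)%N; have [L [l hl]] := good_subpoly he (2 * m)%N.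
exists (L + K), (fun N => l N * k N) => N.
have [a1 a2 [ss [s1 s2 s3 s4]]] := hk N; have [b1 b2 b3] := hl N.
have l0 : 0 < l N by lra.
split; first by rewrite mulr_ege1.
  by apply: pow_prod_le => //; lra.
exists ((e.1, (Num.sqrt (l N))^-1%:C *: pmx e N) :: ss); split.
- by apply/contrs_cons; split => //; exact: opb_contr.
- by move=> g; rewrite inE => /orP[/eqP->|]; [rewrite ntrZ h0 mulr0|exact: s2].
- by rewrite /= s3.
- move=> Z /=; rewrite s4 sqrtrM ?(ltW l0)// rmorphM -scalerA.
  have s0 : Num.sqrt (l N) != 0 by rewrite gt_eqF// sqrtr_gt0.
  have -> : letter Z (e.1, (Num.sqrt (l N))^-1%:C *: pmx e N) =
     (Num.sqrt (l N))^-1%:C *: letter Z (e.1, pmx e N).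
    by rewrite /letter /=; case: e.1; rewrite // -scalemxAr -scalemxAl.
  rewrite -scalemxAr -scalemxAl !scalerA -!rmorphM /=.
  by congr (_%:C *: _); field.
Qed.

Definition palt es := sorted (fun e f => e.1 != f.1) es.

Lemma map_fst_alternating n (ss : seq (bool * 'M[C]_n)) es :
  map fst ss = map fst es -> palt es -> alternates ss.
Proof.
rewrite /palt /alternates => h hs.
have : sorted (fun a b : bool => a != b) (map fst ss) by rewrite h sorted_map.
by rewrite sorted_map.
Qed.

Lemma map_fst_has n (ss : seq (bool * 'M[C]_n)) es :
  map fst ss = map fst es -> has fst ss = has fst es.
Proof.
move=> h; have : has id (map fst ss) = has id (map fst es) by rewrite h.
by rewrite !has_map.
Qed.

(** [|X|^4 = k^2 |Y|^4], and [k^4 <= K (N + 1)] makes [k^2] at most of order [N^(1/2)], which leaves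
    a mean of order [N^(-3/2)]. *)
Lemma ae_cvg0_of_scaled (X : nat -> T -> C) (c K : R) (k : nat -> R)
  : 0 <= c ->
  (forall N, exists Y : T -> C, [/\ 1 <= k N, k N ^+ 4 <= K * N.+1%:R,
     forall w, X N w = (Num.sqrt (k N))%:C * Y w,
     bmeas (fun w => cabs (Y w) ^+ 4) &
     Ex P (fun w => cabs (Y w) ^+ 4) <= c / N.+1%:R ^+ 2]) ->
  {ae P, forall w, cvgC (fun N => X N w) 0}.
Proof.
move=> c0 h.
have e N (Y : T -> C) : 1 <= k N -> (forall w, X N w = (Num.sqrt (k N))%:C * Y w) ->
    forall w, cabs (X N w) ^+ 4 = k N ^+ 2 * cabs (Y w) ^+ 4.
  move=> k1 hX w; rewrite hX cabsM exprMn cabs_real ger0_norm ?sqrtr_ge0//.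
  congr (_ * _); have k0 : 0 <= k N by lra.
  by rewrite -{2}(sqr_sqrtr k0) -exprM.
have : {ae P, forall w, (fun N => cabs (X N w) ^+ 4) @ \oo --> (0 : R)}.
  apply: (@ae_cvg0_of_mean _ _ _ P (fun N w => cabs (X N w) ^+ 4) (Num.sqrt K * c)).
  - by move=> N w; rewrite exprn_ge0// cabs_ge0.
  - move=> N; have [Y [k1 _ hX bY _]] := h N.
    by under eq_fun do rewrite (e N Y)//; exact: bmeasZ.
  - move=> N; have [Y [k1 k4 hX bY hY]] := h N.
    have -> : (fun w => cabs (X N w) ^+ 4) = (fun w => k N ^+ 2 * cabs (Y w) ^+ 4).
      by apply/funext => w; exact: e.
    rewrite ExZ//; set n : R := N.+1%:R in k4 hY *.
    have n0 : 0 < n by rewrite ltr0n.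
    have s0 : Num.sqrt n != 0 by rewrite gt_eqF// sqrtr_gt0.
    have hk : k N ^+ 2 <= Num.sqrt K * Num.sqrt n.
      have K0 : 0 <= K.
        rewrite -(pmulr_lge0 _ n0); apply: le_trans k4; apply: exprn_ge0; lra.
      rewrite -sqrtrM// -(ler_pXn2r (_ : (0 < 2)%N)) ?nnegrE ?sqr_ge0 ?sqrtr_ge0//.
      by rewrite sqr_sqrtr ?mulr_ge0 ?(ltW n0)// -exprM.
    apply: (@le_trans _ _ (Num.sqrt K * Num.sqrt n * (c / n ^+ 2))).
      by apply: ler_pM => //; [exact: sqr_ge0|apply: Rintegral_ge0 => w _; rewrite exprn_ge0// cabs_ge0].
    rewrite le_eqVlt; apply/orP; left; apply/eqP.
    have ns := sqr_sqrtr (ltW n0); move: s0 ns {hk}; move: (Num.sqrt n) => s s0 <-.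
    by field.
by apply: filterS => w hw; exact: cvgC_pow4.
Qed.

Lemma null_inner es : Forall good es -> Forall (fun e => forall N, ntr (pmx e N) = 0) es ->
  palt es -> has fst es -> {ae P, forall w, cvgC (fun N => Xin es N w) 0}.
Proof.
move=> he h0 ha hb; have [K [k hk]] := pscale he h0 4.
have [c c0 hc] := word_bound_exists P (size es).
apply: (@ae_cvg0_of_scaled _ c K k) => // N.
have [k1 k4 [ss [s1 s2 s3 s4]]] := hk N.
have sv : sqn (conjv (v N)) <= 1 by rewrite sqn_conj hv.
have sv' : sqn (v N) <= 1 by rewrite hv.
exists (fun w => dot (conjv (v N)) (mword (U N w) ss *m v N)); split => //.
- by move=> w; rewrite /Xin /Xmx s4 innerE -scalemxAl dotZr.
- exact: word4_bmeas.
- apply: (hc _ _ (hU N)) => //.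
  + by rewrite -(size_map fst ss) s3 size_map.
  + exact: map_fst_alternating s3 ha.
  + by rewrite (map_fst_has s3).
Qed.

Lemma null_trace es : Forall good es -> Forall (fun e => forall N, ntr (pmx e N) = 0) es ->
  palt es -> (0 < size es)%N -> {ae P, forall w, cvgC (fun N => Xtr es N w) 0}.
Proof.
move=> he h0 ha hs; have [K [k hk]] := pscale he h0 4.
have [c c0 hc] := word_bound_exists P (size es).
apply: (@ae_cvg0_of_scaled _ c K k) => // N.
have [k1 k4 [ss [s1 s2 s3 s4]]] := hk N.
exists (fun w => ntr (mword (U N w) ss)); split => //.
- by move=> w; rewrite /Xtr /Xmx s4 ntrZ.
- exact: trace4_bmeas.
- apply: (trace_bound c0 hc (hU N)) => //.
  + by rewrite -(size_map fst ss) s3 size_map hs leqnn.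
  + exact: map_fst_alternating s3 ha.
Qed.

Definition ae_limit (X : nat -> T -> C) (l : C) := {ae P, forall w, cvgC (fun N => X N w) l}.

Lemma ae_limit_ext X Y l : (forall N w, X N w = Y N w) -> ae_limit X l -> ae_limit Y l.
Proof.
move=> e; apply: filterS => w; congr cvgC.
by apply/funext => N; rewrite e.
Qed.

Lemma ae_limitDM X Y (t : nat -> C) l l' s : ae_limit X l -> cvgC t s -> ae_limit Y l' ->
  ae_limit (fun N w => X N w + t N * Y N w) (l + s * l').
Proof.
move=> hX ht; apply: filterS2 hX => w hX hY.
by apply: cvgCD => //; exact: cvgCM.
Qed.

Definition limits es := (exists l, ae_limit (Xtr es) l) /\ (exists l, ae_limit (Xin es) l).
Definition asymp_centered e := cvgC (fun N => ntr (pmx e N)) 0.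

Lemma palt_center (pre post : seq pletter) e : palt (pre ++ e :: post) ->
  palt (rcons pre (pcenter e) ++ post).
Proof.
rewrite cat_rcons /palt => h.
have hm es : sorted (fun e f => e.1 != f.1) es = sorted (fun a b : bool => a != b) (map fst es).
  by rewrite sorted_map.
by move: h; rewrite !hm !map_cat.
Qed.

(** [pre] holds the letters already centred exactly, [post] those still to be treated. Centring one
    more letter adds its trace times a shorter word, perhaps no longer alternating, whose limits
    exist by the first hypothesis. If that trace tends to 0 the correction disappears, which gives
    the clauses on the value 0. *)
Lemma limits_alternating n post pre :
  (forall es, (size es < n)%N -> Forall good es -> limits es) ->
  size (pre ++ post) = n -> palt (pre ++ post) ->
  Forall good pre -> Forall good post ->
  Forall (fun e => forall N, ntr (pmx e N) = 0) pre ->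
  (exists2 l, ae_limit (Xtr (pre ++ post)) l &
     (0 < n)%N -> Forall asymp_centered post -> l = 0) /\
  (exists2 l, ae_limit (Xin (pre ++ post)) l &
     has fst (pre ++ post) -> Forall asymp_centered post -> l = 0).
Proof.
move=> IHn; elim: post pre => [|e post IH] pre.
  rewrite cats0 => hn ha gpre _ h0; split.
    case: pre => [|e pre] in hn ha gpre h0 *; last first.
      by exists 0 => //; apply: null_trace.
    exists 1; last by rewrite -hn.
    apply: (@ae_limit_ext (fun _ _ => 1)); last by apply: aeW => w; exact: cvgC_cst.
    by move=> N w; rewrite /Xtr /Xmx /= ntr_scalar.
  have [hb|hb] := boolP (has fst pre); first by exists 0 => //; exact: null_inner.
  have : (size pre <= 1)%N.
    by move: ha hb; rewrite /palt; case: (pre) => [|[[] a] [|[[] b] s]].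
  case: pre => [|[b p] [|//]] in hn ha gpre h0 hb * => _.
    exists 1 => //; apply: (@ae_limit_ext (fun _ _ => 1)); last by apply: aeW => w; exact: cvgC_cst.
    by move=> N w; rewrite /Xin /Xmx /= mul1mx sqn_inner hv.
  case: b => // in hn ha gpre h0 hb *.
  (* A lone centred A-letter need not vanish in the vector state: its limit comes from the assumed
     moments of [A] at [v]. *)
  have [l hl] := good_inner gpre.1 erefl.
  exists l => //; apply: (ae_limit_ext _ (aeW _ (fun=> hl))) => N w.
  by rewrite /Xin /Xmx /= mulmx1.
move=> hn ha gpre [ge gpost] h0.
have ga : palt (rcons pre (pcenter e) ++ post) by exact: palt_center.
have sz : size (rcons pre (pcenter e) ++ post) = n by rewrite cat_rcons -hn !size_cat.
have gp : Forall good (rcons pre (pcenter e)).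
  by rewrite -cats1; apply/Forall_cat; split => //; split => //; exact: good_center.
have zp : Forall (fun e => forall N, ntr (pmx e N) = 0) (rcons pre (pcenter e)).
  by rewrite -cats1; apply/Forall_cat; split => //; split => // N; exact: ntr_pcenter.
have [[l1 hl1 z1] [l2 hl2 z2]] := IH _ sz ga gp gpost zp.
have [t ht] := good_trace ge.
have [[s1 hs1] [s2 hs2]] : limits (pre ++ post).
  apply: IHn; first by rewrite -hn !size_cat /= addnS.
  exact/Forall_cat.
split.
  exists (l1 + t * s1).
    apply: ae_limit_ext (ae_limitDM hl1 ht hs1) => N w.
    by rewrite /Xtr Xmx_center ntrD ntrZ.
  by move=> n0 [ce cpost]; rewrite (z1 n0 cpost) (cvgC_unique ht ce) mul0r addr0.
exists (l2 + t * s2).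
  apply: ae_limit_ext (ae_limitDM hl2 ht hs2) => N w.
  by rewrite /Xin Xmx_center mulmxDl -scalemxAl !innerE dotDr dotZr.
move=> hb [ce cpost]; rewrite z2 ?(cvgC_unique ht ce) ?mul0r ?addr0//.
by move: hb; rewrite cat_rcons !has_cat.
Qed.

Lemma not_palt es : ~~ palt es -> exists s1 e f s2, es = s1 ++ e :: f :: s2 /\ e.1 = f.1.
Proof.
rewrite /palt; elim: es => [//|e [//|f es] IH] /=.
have [ef|ef] := eqVneq e.1 f.1; first by exists [::], e, f, es.
by move=> /IH[s1 [e' [f' [s2 [-> h]]]]]; exists (e :: s1), e', f', s2.
Qed.

Lemma limits_exist n es : (size es < n)%N -> Forall good es -> limits es.
Proof.
elim: n es => // n IH es hs ge.
have [ha|/not_palt[s1 [e [f [s2 [ees ef]]]]]] := boolP (palt es).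
  have IH' fs : (size fs < size es)%N -> Forall good fs -> limits fs.
    by move=> h; apply: IH; exact: leq_trans h hs.
  have [[l1 h1 _] [l2 h2 _]] := limits_alternating (pre := [::]) IH' erefl ha I ge I.
  by split; [exists l1|exists l2].
have : limits (s1 ++ pmerge e f :: s2).
  apply: IH; first by move: hs; rewrite ees !size_cat /= !addnS.
  move: ge; rewrite ees => /Forall_cat[g1 [g2 [g3 g4]]].
  by apply/Forall_cat; split => //; split => //; exact: good_merge.
case=> [[l1 h1] [l2 h2]]; split.
  by exists l1; apply: ae_limit_ext h1 => N w; rewrite /Xtr ees Xmx_merge.
by exists l2; apply: ae_limit_ext h2 => N w; rewrite /Xin ees Xmx_merge.
Qed.

Lemma limits_asymp_centered es : Forall good es -> palt es -> Forall asymp_centered es ->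
  ((0 < size es)%N -> ae_limit (Xtr es) 0) /\ (has fst es -> ae_limit (Xin es) 0).
Proof.
move=> ge ha ce.
have IH' fs : (size fs < size es)%N -> Forall good fs -> limits fs by exact: limits_exist.
have [[l1 h1 z1] [l2 h2 z2]] := limits_alternating (pre := [::]) IH' erefl ha I ge I.
split => h; first by rewrite -(z1 h ce).
by rewrite -(z2 h ce).
Qed.

(** * The limiting functionals and conditional freeness *)

Lemma good_const b (p : {poly C}) : good (b, fun _ => p).
Proof.
split; first by exists (size p).
by move=> k; exists p`_k; exact: cvgC_cst.
Qed.

Definition pword (w : word) : seq pletter := [seq (b, fun=> 'X) | b <- w].

Lemma good_pword w : Forall good (pword w).
Proof. by elim: w => //= b w IH; split => //; exact: good_const. Qed.

Lemma Xmx_pword w N o :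
  Xmx (pword w) N o = ev_word w (A N) (U N o *m B N *m mxadj (U N o)).
Proof.
elim: w => //= b w IH; rewrite -IH /Xmx /=; congr (_ *m _).
by rewrite /letter /pmx /= horner_mx_X; case: b.
Qed.

(** The limit is a constant quantified outside the almost sure statement, so it can be chosen word
    by word. *)
Definition tau (w : word) : C := projT1 (cid (limits_exist (ltnSn _) (good_pword w)).1).
Definition phi (w : word) : C := projT1 (cid (limits_exist (ltnSn _) (good_pword w)).2).

Lemma tauP w : ae_limit (Xtr (pword w)) (tau w).
Proof. by rewrite /tau; case: cid. Qed.

Lemma phiP w : ae_limit (Xin (pword w)) (phi w).
Proof. by rewrite /phi; case: cid. Qed.

Definition evU (p : ncpoly R) N o := ev p (A N) (U N o *m B N *m mxadj (U N o)).

Lemma ae_limit_lin (f : word -> C) (X : word -> nat -> T -> C) (p : ncpoly R) :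
  (forall w, ae_limit (X w) (f w)) ->
  ae_limit (fun N o => \sum_(m <- p) m.1 * X m.2 N o) (lin f p).
Proof.
move=> h; rewrite /lin; elim: p => [|[c w] p IH].
  apply: aeW => o; rewrite big_nil; under eq_fun do rewrite big_nil.
  exact: cvgC_cst.
rewrite big_cons; apply: filterS2 (h w) IH => o h1 h2.
under eq_fun do rewrite big_cons.
by apply: cvgCD => //; apply: cvgCM => //; exact: cvgC_cst.
Qed.

Lemma tau_lin p : ae_limit (fun N o => ntr (evU p N o)) (lin tau p).
Proof.
apply: ae_limit_ext (ae_limit_lin p tauP) => N o.
rewrite /evU /ev ntr_sum; apply: eq_bigr => m _.
by rewrite ntrZ /Xtr Xmx_pword.
Qed.

Lemma phi_lin p : ae_limit (fun N o => inner (evU p N o *m v N) (v N)) (lin phi p).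
Proof.
apply: ae_limit_ext (ae_limit_lin p phiP) => N o.
rewrite /evU /ev mulmx_suml inner_suml; apply: eq_bigr => m _.
by rewrite -scalemxAl innerE dotZr -innerE /Xin Xmx_pword.
Qed.

(** The whole space is not null, so a deterministic statement that holds almost surely holds; this
    is how almost sure limits are shown to be unique. *)
Lemma ae_const (Q : Prop) : {ae P, forall w : T, Q} -> Q.
Proof.
move=> h; apply: contrapT => nQ.
have : P setT = 0%E.
  apply: measure_negligible => //; apply: negligibleS h => w _ /=.
  exact.
by rewrite probability_setT => /eqP; rewrite onee_eq0.
Qed.

Lemma ae_limit_unique X l l' : ae_limit X l -> ae_limit X l' -> l = l'.
Proof.
move=> h h'; apply: ae_const; apply: filterS2 h h' => w.
exact: cvgC_unique.
Qed.

Lemma ae_limit_det (u : nat -> C) l : ae_limit (fun N _ => u N) l -> cvgC u l.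
Proof. by move=> h; apply: ae_const; apply: filterS h. Qed.

Lemma ev_cat (p q : ncpoly R) n (M1 M2 : 'M[C]_n) : ev (p ++ q) M1 M2 = ev p M1 M2 + ev q M1 M2.
Proof. by rewrite /ev big_cat. Qed.

Lemma ev_word_cat w w' n (M1 M2 : 'M[C]_n) :
  ev_word (w ++ w') M1 M2 = ev_word w M1 M2 *m ev_word w' M1 M2.
Proof. by elim: w => [|b w IH] /=; rewrite ?mul1mx// IH mulmxA. Qed.

Lemma ev_ncmul (p q : ncpoly R) n (M1 M2 : 'M[C]_n) :
  ev (ncmul p q) M1 M2 = ev p M1 M2 *m ev q M1 M2.
Proof.
rewrite /ncmul; elim: p => [|m p IH]; first by rewrite /ev !big_nil mul0mx.
rewrite /= ev_cat [X in _ + X]IH [ev (m :: p) _ _]/ev big_cons mulmxDl; congr +%R.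
rewrite /ev big_map mulmx_sumr; apply: eq_bigr => m' _ /=.
by rewrite ev_word_cat -scalemxAl -scalemxAr scalerA.
Qed.

Definition pemb (a : bool * poly1 R) : pletter :=
  (a.1, fun=> \sum_(m <- a.2) m.1 *: 'X^(m.2)).

(** Conjugation by a unitary is a unital algebra morphism, so a polynomial in [U B U^*] is the
    conjugate of the polynomial in [B]. *)
Lemma evU_emb a N o : evU (emb a.1 a.2) N o = letter (U N o) (a.1, pmx (pemb a) N).
Proof.
have [h _ _] := hU N; case: a => b a.
have hp k : ev_word (nseq k b) (A N) (U N o *m B N *m mxadj (U N o)) =
    letter (U N o) (b, base b N ^+ k).
  elim: k => [|k IH] /=.
    by rewrite /letter /= expr0; case: b; rewrite // mulmx1 (unitary_mulVr (h o)).
  rewrite IH /letter /= exprS; case: b {IH} => //.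
  rewrite -!mulmxA; congr (_ *m (_ *m _)).
  by rewrite (mulmxA (mxadj _)) h mul1mx.
rewrite /evU /ev /emb big_map /= /pmx /= rmorph_sum /=.
elim: a => [|m a IH].
  by rewrite !big_nil /letter /=; case: b {hp}; rewrite // mulmx0 mul0mx.
rewrite !big_cons IH /= hp horner_mxZ rmorphXn /= horner_mx_X /letter /=.
by case: b {hp IH}; rewrite // mulmxDr mulmxDl -scalemxAr -scalemxAl.
Qed.

Lemma evU_ncprod (s : seq (bool * poly1 R)) N o :
  evU (ncprod [seq emb a.1 a.2 | a <- s]) N o = Xmx [seq pemb a | a <- s] N o.
Proof.
elim: s => [|a s IH]; first by rewrite /evU /ev big_seq1 scale1r.
by rewrite /evU /= ev_ncmul [X in X *m _]evU_emb [X in _ *m X]IH.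
Qed.

Lemma tau_phi_cond_free : cond_free tau phi.
Proof.
move=> s s1 hs h0.
(* The trace of a single letter does not depend on [U], so [tau] vanishing on it is a deterministic
   statement about its trace. *)
have cs a : a \in s -> asymp_centered (pemb a).
  move=> /h0 ha; apply: ae_limit_det.
  rewrite -ha; apply: ae_limit_ext (tau_lin (emb a.1 a.2)) => N o.
  by rewrite evU_emb (ntr_letter (hU N)).
have gs (s' : seq (bool * poly1 R)) : Forall good [seq pemb a | a <- s'].
  by elim: s' => //= a s' IH; split => //; exact: good_const.
have fs : Forall asymp_centered [seq pemb a | a <- s].
  elim: (s) cs => //= a s' IH cs; split; first by apply: cs; rewrite mem_head.
  by apply: IH => b hb; apply: cs; rewrite inE hb orbT.
have as_ : palt [seq pemb a | a <- s] by rewrite /palt sorted_map.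
have [t1 t2] := limits_asymp_centered (gs s) as_ fs.
have hb : has fst s.
  by move: s1 hs; case: (s) => [|[[] a] [|[[] b] s']].
have hb' : has fst [seq pemb a | a <- s] by rewrite has_map.
have lt : ae_limit (fun N o => ntr (evU (ncprod [seq emb a.1 a.2 | a <- s]) N o)) 0.
  apply: ae_limit_ext (t1 _); first by move=> N o; rewrite evU_ncprod.
  by rewrite size_map ltnW.
have lp : ae_limit (fun N o =>
    inner (evU (ncprod [seq emb a.1 a.2 | a <- s]) N o *m v N) (v N)) 0.
  by apply: ae_limit_ext (t2 hb') => N o; rewrite evU_ncprod.
rewrite (ae_limit_unique (tau_lin _) lt) (ae_limit_unique (phi_lin _) lp); split => //.
(* The product of the values of [phi] also vanishes: its factor at a B-letter is the limit of a
   one-letter centred word containing a B-letter. *)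
have [a sa ba] := hasP hb; rewrite (big_rem a)//=.
suff -> : lin phi (emb a.1 a.2) = 0 by rewrite mul0r.
apply: ae_limit_unique (phi_lin _) _.
have [_ h] := limits_asymp_centered (gs [:: a]) isT (conj (cs a sa) I).
apply: ae_limit_ext (h _); last by rewrite /= ba.
by move=> N o; rewrite /Xin /Xmx /= mulmx1 evU_emb.
Qed.

Lemma tau_unital : unital tau.
Proof.
apply: ae_limit_unique (tauP [::]) _; apply: aeW => w.
have -> : (fun N => Xtr (pword [::]) N w) = fun=> 1; last exact: cvgC_cst.
by apply/funext => N; rewrite /Xtr /Xmx /= ntr_scalar.
Qed.

Lemma phi_unital : unital phi.
Proof.
apply: ae_limit_unique (phiP [::]) _; apply: aeW => w.
have -> : (fun N => Xin (pword [::]) N w) = fun=> 1; last exact: cvgC_cst.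
by apply/funext => N; rewrite /Xin /Xmx /= mul1mx sqn_inner hv.
Qed.

End PolynomialLetters.

Local Open Scope complex_scope.

(* Matrices of size N+1 are indexed by N : nat (so that N >= 1). *)
Theorem theorem1p2 (R : realType) (realc : bool)
  (A B : forall N : nat, 'M[R[i]]_N.+1) (v : forall N : nat, 'cV[R[i]]_N.+1)
  (mu1 nu1 mu2 : probability R R)
  (d : measure_display) (Omega : measurableType d) (P : probability Omega R)
  (U : forall N : nat, Omega -> 'M[R[i]]_N.+1) :
  (forall N, selfadj realc (A N)) ->
  (forall N, selfadj realc (B N)) ->
  (forall N, admissible_vec realc (v N)) ->
  has_moments mu1 -> has_moments nu1 -> has_moments mu2 ->
  (forall k : nat, cvgC (fun N => ntr (A N ^+ k)) (moment mu1 k)%:C) ->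
  (forall k : nat, cvgC (fun N => inner (A N ^+ k *m v N) (v N)) (moment nu1 k)%:C) ->
  (forall k : nat, cvgC (fun N => ntr (B N ^+ k)) (moment mu2 k)%:C) ->
  (forall N, haar P realc (U N)) ->
  exists tau phi : word -> R[i],
    [/\ unital tau, unital phi,
     (forall p : ncpoly R, {ae P, forall w,
        cvgC (fun N => ntr (ev p (A N) (U N w *m B N *m mxadj (U N w))))
             (lin tau p)}),
     (forall p : ncpoly R, {ae P, forall w,
        cvgC (fun N => inner (ev p (A N) (U N w *m B N *m mxadj (U N w)) *m v N) (v N))
             (lin phi p)})
     & cond_free tau phi].
Proof.
move=> sA sB sv _ _ _ mA mv mB hU.
have hA N : Defs.hermitian (A N) by have [] := sA N.
have hB N : Defs.hermitian (B N) by have [] := sB N.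
have hv N : sqn (v N) = 1.
  by apply: (@complexI R); rewrite -sqn_inner; have [] := sv N.
have eA k : exists l, cvgC (fun N => ntr (A N ^+ k)) l by eexists; exact: mA.
have ev k : exists l, cvgC (fun N => inner (A N ^+ k *m v N) (v N)) l by eexists; exact: mv.
have eB k : exists l, cvgC (fun N => ntr (B N ^+ k)) l by eexists; exact: mB.
have hR N := regularise_rot_inv (hU N).
(* One null set for each [N]; their countable union is still null, so limits in [N] are unaffected
   by the regularisation. *)
have hae : {ae P, forall w, forall N, regularise (U N) w = U N w}.
  by apply: ae_foralln => N; exact: regularise_ae (hU N).
exists (tau hA hB hv eA ev eB hR), (phi hA hB hv eA ev eB hR); split.
- exact: tau_unital.
- exact: phi_unital.
- move=> p; apply: filterS2 hae (tau_lin hA hB hv eA ev eB hR p) => w hw.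
  by apply: cvgC_ext => N; rewrite /evU hw.
- move=> p; apply: filterS2 hae (phi_lin hA hB hv eA ev eB hR p) => w hw.
  by apply: cvgC_ext => N; rewrite /evU hw.
- exact: tau_phi_cond_free.
Qed.
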